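(* Consider the $5x+1$ branching random walk $\mathcal B[5^0]$ started from a single individual at a fixed real position. For a realization $\omega$, let $\omega_{k,i}$ ($1\le i\le N_k(\omega)$) be the individuals of generation $k$ with positions $L(\omega_{k,i})$ and sizes $Z(\omega_{k,i})=e^{L(\omega_{k,i})}$, and let $$I^*(x;\omega)=\#\{\omega_{k,i}:\ Z(\omega_{k,i})\le x,\ k\ge1,\ 1\le i\le N_k(\omega)\}.$$ Then with probability one $$I^*(x;\omega)=x^{\eta_{5,BP}+o(1)}\quad\text{as }x\to\infty,$$ where $\eta_{5,BP}$ is the maximum value of $f(a)=\overline g_{5,BP}(a)/a$ over $0<a<\tfrac16\log\tfrac{64}{5}$, with $$\overline g_{5,BP}(a)=-\sup_{\theta\le0}\Big(a\theta-\log\big(2^\theta+\tfrac15(\tfrac25)^\theta\big)\Big)$$ (numerically $\eta_{5,BP}\approx0.650919$).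
   Context: The branching random walk $\mathcal B[5^0]$ has one type of individual. Each individual in generation $k-1$ at position $y$, independently of all others, has with probability $\tfrac45$ a single child in generation $k$ at position $y+\log2$, and with probability $\tfrac15$ two children in generation $k$, at positions $y+\log 2$ and $y+\log\tfrac25$. $N_k(\omega)$ is the number of individuals in generation $k$. *)

(* Defs.v *)
From mathcomp Require Import all_boot all_order all_algebra.
From mathcomp Require Import all_classical all_reals all_analysis.

Set Implicit Arguments.
Unset Strict Implicit.
Unset Printing Implicit Defensive.

Import Order.TTheory GRing.Theory Num.Theory.
Import numFieldNormedType.Exports.

Local Open Scope classical_set_scope.
Local Open Scope ring_scope.

(* Individuals carry Ulam-Harris labels in [seq bool]: the root is [::], and an
   individual u has the child [rcons u false] displaced by log 2 and possibly
   the child [rcons u true] displaced by log (2/5). *)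
Definition label := seq bool.

(* [two u] is the event that u has two children; the variables at labels that
   are never born do not affect the process. *)
Definition reproduction_law (R : realType) (d : measure_display)
    (T : measurableType d) (P : probability T R)
    (two : label -> {RV P >-> bool}) : Prop :=
  forall u, P (two u @^-1` [set false]) = (4 / 5)%:E /\
            P (two u @^-1` [set true]) = (1 / 5)%:E.

Definition mutually_independent (R : realType) (d : measure_display)
    (T : measurableType d) (P : probability T R)
    (two : label -> {RV P >-> bool}) : Prop :=
  forall (s : seq label) (A : label -> set bool), uniq s ->
    P (\bigcap_(u in [set` s]) (two u @^-1` A u)) =
    (\prod_(u <- s) P (two u @^-1` A u))%E.

Section realization.
Variables (R : realType) (start : R) (two : label -> bool).

Definition individual := (label * R)%type.

Definition children (v : individual) : seq individual :=
  let: (u, y) := v in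
  if two u
  then [:: (rcons u false, y + ln 2); (rcons u true, y + ln (2 / 5))]
  else [:: (rcons u false, y + ln 2)].

Fixpoint generation (k : nat) : seq individual :=
  if k is k'.+1 then flatten [seq children v | v <- generation k']
  else [:: ([::], start)].

Definition N (k : nat) : nat := size (generation k).

(* The individuals of generation k are numbered from 0 to N k - 1. *)
Definition L (k i : nat) : R := (nth ([::], 0) (generation k) i).2.

Definition Z (k i : nat) : R := expR (L k i).

Definition Istar (x : R) : \bar R :=
  counting [set ki : nat * nat |
    [/\ (1 <= ki.1)%N, (ki.2 < N ki.1)%N & Z ki.1 ki.2 <= x]].

End realization.

(* F x = x ^ (eta + o(1)) as x --> +oo. *)
Definition power_asymptotics (R : realType) (F : R -> \bar R) (eta : R) : Prop :=
  exists eps : R -> R,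
    eps x @[x --> +oo] --> (0 : R) /\
    \forall x \near +oo, F x = (x `^ (eta + eps x))%:E.

(* The set is bounded above for every a > log (2/5), so [sup] is the genuine
   supremum on the range 0 < a used below. *)
Definition g5BP (R : realType) (a : R) : R :=
  - sup [set a * theta - ln (2 `^ theta + 1 / 5 * (2 / 5) `^ theta)
        | theta in [set theta : R | theta <= 0]].

Definition f5BP (R : realType) (a : R) : R := g5BP a / a.

Definition is_maximum_on (R : realType) (A : set R) (f : R -> R) (m : R) : Prop :=
  (exists2 a, A a & f a = m) /\ (forall a, A a -> f a <= m).

(* Main.v *)
(** Write [phi l = 2^(-l) + (1/5)(5/2)^l], the expectation of the sum of
    [exp (- l * X)] over the displacements [X] of the children of one individual.
    The exponent [eta] is the smaller root of [phi l = 1] (the other one is 1),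
    and the tangent line of [ln phi] at [eta] has slope [- drift], where [drift]
    is the point at which [f] reaches its maximum [eta].

    Upper bound: for [l] slightly above [eta], [phi l < 1], so by Markov's
    inequality and Borel-Cantelli the sum of [Z ^ (- l)] over all individuals is
    almost surely finite.

    Lower bound: by Chebyshev's inequality under the weights tilted by [eta], for
    large [K] the expected number [mu] of descendants [K] generations later with
    displacement at most [D], about [K * drift], satisfies
    [ln mu > (eta - eps) * (D + ln 2)].  Iterating such blocks gives a
    supercritical Galton-Watson process whose second moment is of order
    [mu ^ (2 n)], so by Paley-Zygmund it has at least [mu ^ n / 20] members at
    step [n] with probability bounded below.  The line of first children
    [spine j], [j < n], provides [n] independent attempts at a cost of at most
    [n * ln 2] in position, hence all of them fail with exponentially small
    probability, and Borel-Cantelli applies again. *)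
Require Import Defs.
From Stdlib Require Import NArith Lia.
From mathcomp Require Import all_boot all_order all_algebra.
From mathcomp Require Import finmap.
From mathcomp Require Import all_classical all_reals all_analysis.
From mathcomp Require Import measurable_realfun.
From mathcomp Require Import ring lra.

Set Implicit Arguments.
Unset Strict Implicit.
Unset Printing Implicit Defensive.

Import Order.TTheory GRing.Theory Num.Theory.
Import numFieldNormedType.Exports.

Local Open Scope classical_set_scope.
Local Open Scope ring_scope.

(** * Certified rational bounds on powers with rational exponents *)

Section PowerBounds.
Variable R : realType.

(** Binary integers allow [vm_compute] to check the numerical certificates. *)
Definition natr (n : BinNums.N) : R := (N.to_nat n)%:R.

Lemma natrNM m n : natr (m * n) = natr m * natr n.
Proof. by rewrite /natr N2Nat.inj_mul natrM. Qed.

Lemma natrND m n : natr (m + n) = natr m + natr n.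
Proof. by rewrite /natr N2Nat.inj_add natrD. Qed.

Lemma natrN_ge0 n : 0 <= natr n.
Proof. exact: ler0n. Qed.

Lemma natrN_le m n : (m <= n)%num -> natr m <= natr n.
Proof. by move=> mn; rewrite ler_nat; apply/ssrnat.leP; lia. Qed.

Lemma natrN_lt m n : (m < n)%num -> natr m < natr n.
Proof. by move=> mn; rewrite ltr_nat; apply/ssrnat.ltP; lia. Qed.

Lemma natrN_gt0 n : (0 < n)%num -> 0 < natr n.
Proof. exact: natrN_lt. Qed.

Definition muldiv_up (x y z : BinNums.N) : BinNums.N := N.succ (x * y / z).

Lemma muldiv_upP x y z : (0 < z)%num ->
  natr x * (natr y / natr z) <= natr (muldiv_up x y z).
Proof.
move=> z0; rewrite mulrA ler_pdivrMr ?natrN_gt0// -!natrNM; apply: natrN_le.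
have := N.mul_succ_div_gt (x * y) z; rewrite /muldiv_up; lia.
Qed.

(* Square-and-multiply for [(p/q)^e * (c/d)^k], the binary digits of [e] and [k]
   being read in parallel from [l]; the value is held in units of [1/S] and
   rounded up.  The two factors nearly cancel in the instances below, so that the
   intermediate values stay close to 1 and all numbers stay small. *)
Fixpoint power_up (S p q c d r : BinNums.N) (l : seq (bool * bool)) : BinNums.N :=
  if l is (b, b') :: l' then
    let r1 := muldiv_up r r S in
    let r2 := if b then muldiv_up r1 p q else r1 in
    let r3 := if b' then muldiv_up r2 c d else r2 in
    power_up S p q c d r3 l'
  else r.

Definition read_bits (e : nat) (l : seq bool) : nat :=
  foldl (fun e (b : bool) => (e + e + b)%N) e l.

(** Loop invariant: [e] and [k] are the exponents read so far, and [r / S] bounds the product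
    reached. Rounding up preserves the bound. *)
Lemma power_upP (S p q c d : BinNums.N) (l : seq (bool * bool)) (r : BinNums.N) (e k : nat)
    (x := natr p / natr q) (y := natr c / natr d) :
  (0 < S)%num -> (0 < q)%num -> (0 < d)%num ->
  natr S * (x ^+ e * y ^+ k) <= natr r ->
  natr S * (x ^+ read_bits e (unzip1 l) * y ^+ read_bits k (unzip2 l)) <=
  natr (power_up S p q c d r l).
Proof.
move=> S0 q0 d0.
have x0 : 0 <= x by rewrite divr_ge0 ?natrN_ge0.
have y0 : 0 <= y by rewrite divr_ge0 ?natrN_ge0.
have SR : 0 < natr S by exact: natrN_gt0.
elim: l r e k => [//|[b b'] l IHl] r e k hr /=; apply: IHl.
set r1 := muldiv_up r r S.
have h1 : natr S * (x ^+ (e + e) * y ^+ (k + k)) <= natr r1.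
  apply: le_trans (muldiv_upP r r S0); rewrite [leRHS]mulrA ler_pdivlMr//.
  have -> : natr S * (x ^+ (e + e) * y ^+ (k + k)) * natr S =
      (natr S * (x ^+ e * y ^+ k)) * (natr S * (x ^+ e * y ^+ k)).
    by rewrite !exprD; ring.
  by apply: ler_pM => //; rewrite mulr_ge0 ?(ltW SR)// mulr_ge0 ?exprn_ge0.
set r2 := if b then _ else _.
have h2 : natr S * (x ^+ (e + e + b) * y ^+ (k + k)) <= natr r2.
  rewrite /r2; case: (b); rewrite ?addn0//.
  apply: le_trans (muldiv_upP _ _ q0); rewrite -/x addn1 exprSr.
  have -> : natr S * (x ^+ (e + e) * x * y ^+ (k + k)) =
    natr S * (x ^+ (e + e) * y ^+ (k + k)) * x by ring.
  exact: ler_wpM2r.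
case: (b'); rewrite ?addn0//.
apply: le_trans (muldiv_upP _ _ d0); rewrite -/y addn1 exprSr.
have -> : natr S * (x ^+ (e + e + b) * (y ^+ (k + k) * y)) =
  natr S * (x ^+ (e + e + b) * y ^+ (k + k)) * y by ring.
exact: ler_wpM2r.
Qed.

Lemma power_up_le1 (S p q c d : BinNums.N) (l : seq (bool * bool)) :
  (0 < S)%num -> (0 < q)%num -> (0 < d)%num ->
  (power_up S p q c d S l <= S)%num ->
  (natr p / natr q) ^+ read_bits 0 (unzip1 l) *
  (natr c / natr d) ^+ read_bits 0 (unzip2 l) <= 1.
Proof.
move=> S0 q0 d0 /natrN_le h.
rewrite -(ler_pM2l (natrN_gt0 S0)) mulr1.
by apply: le_trans h; apply: power_upP; rewrite // mul1r mulr1.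
Qed.

(** Taking logarithms, the hypothesis says [x <= y ^ (- k / n)]: an irrational power is compared
    with [x] through integer powers alone. *)
Lemma expR_ge_of_pow (x y : R) (n k : nat) : (0 < n)%N -> 0 < x -> 0 < y ->
  x ^+ n * y ^+ k <= 1 -> x <= expR (- (k%:R / n%:R) * ln y).
Proof.
move=> n0 x0 y0 h; have nR : 0 < n%:R :> R by rewrite ltr0n.
rewrite -[leLHS]lnK ?posrE// ler_expR.
have : ln (x ^+ n * y ^+ k) <= 0 by exact: ln_le0.
rewrite lnM ?posrE ?exprn_gt0// !lnXn// -[ln x *+ n]mulr_natl -[ln y *+ k]mulr_natl => h'.
rewrite -(ler_pM2l nR).
have -> : n%:R * (- (k%:R / n%:R) * ln y) = - (k%:R * ln y) by field; rewrite gt_eqF.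
by lra.
Qed.

Lemma expR_le_of_pow (x y : R) (n k : nat) : (0 < n)%N -> 0 < x -> 0 < y ->
  x^-1 ^+ n * y^-1 ^+ k <= 1 -> expR (- (k%:R / n%:R) * ln y) <= x.
Proof.
move=> n0 x0 y0 /expR_ge_of_pow; rewrite !invr_gt0 => /(_ n0 x0 y0).
by rewrite lnV ?posrE// mulrN expRN lef_pV2 ?posrE ?expR_gt0.
Qed.

End PowerBounds.

(** * The function [phi] and the location of its root *)

Section Root.
Variable R : realType.

Definition phi (l : R) : R :=
  expR (- l * ln 2) + 1 / 5 * expR (- l * ln (2 / 5)).

Lemma phi_powR (theta : R) :
  2 `^ theta + 1 / 5 * (2 / 5) `^ theta = phi (- theta).
Proof. by rewrite /phi opprK /powR !gt_eqF//; lra. Qed.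

(** The tangent at the mean [m] lies below the exponential, and its values at [x] and [y] average to
    [expR m]. *)
Lemma expR_convex (t x y : R) : 0 <= t <= 1 ->
  expR (t * x + (1 - t) * y) <= t * expR x + (1 - t) * expR y.
Proof.
move=> /andP[t0 t1]; set m := _ + _ * y.
have tangent z : expR m * (1 + (z - m)) <= expR z.
  have -> : expR z = expR m * expR (z - m) by rewrite -expRD addrC subrK.
  by rewrite ler_wpM2l ?expR_ge0// expR_ge1Dx.
have -> : expR m = t * (expR m * (1 + (x - m))) + (1 - t) * (expR m * (1 + (y - m))).
  by rewrite /m; ring.
by apply: lerD; rewrite ler_wpM2l// subr_ge0.
Qed.

Lemma phi_convex (t x y : R) : 0 <= t <= 1 ->
  phi (t * x + (1 - t) * y) <= t * phi x + (1 - t) * phi y.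
Proof.
move=> t01; rewrite /phi.
have h c : expR (- (t * x + (1 - t) * y) * c)
    <= t * expR (- x * c) + (1 - t) * expR (- y * c).
  apply: le_trans (expR_convex (- x * c) (- y * c) t01).
  by rewrite ler_expR le_eqVlt; apply/orP; left; apply/eqP; ring.
have := h (ln 2); have := h (ln (2 / 5)); lra.
Qed.

Lemma continuous_phi : continuous phi.
Proof.
have h c : continuous (fun l : R => expR (- l * c)).
  move=> x; apply: continuous_cvg; first exact: continuous_expR.
  by apply: cvgMr_tmp; apply: cvgN; exact: cvg_id.
by move=> x; apply: cvgD; [exact: h | apply: cvgMl_tmp; exact: h].
Qed.

(* The binary digits of 381 and 248. *)
Definition exponent_bits : seq (bool * bool) :=
  [:: (true, false); (false, true); (true, true); (true, true); (true, true);
      (true, true); (true, false); (false, false); (true, false)].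

Lemma natr_small : (natr R 1 = 1) * (natr R 2 = 2) * (natr R 5 = 5).
Proof. by []. Qed.

(** Certificate format: [a / D] and [b / D] are lower bounds for [2 ^ (-248/381)] and
    [(5/2) ^ (248/381)]. The fraction 248/381 lies just below the root. *)
Lemma phi_gt1 (S a b D : BinNums.N) :
  (0 < S)%num -> (0 < a)%num -> (0 < b)%num -> (0 < D)%num ->
  (power_up S a D 2 1 S exponent_bits <= S)%num ->
  (power_up S b D 2 5 S exponent_bits <= S)%num ->
  (5 * D < 5 * a + b)%num -> 1 < phi (248 / 381).
Proof.
move=> S0 a0 b0 D0 pa pb.
have {}pa := @power_up_le1 R S a D 2 1 exponent_bits S0 D0 erefl pa.
have {}pb := @power_up_le1 R S b D 2 5 exponent_bits S0 D0 erefl pb.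
move/(natrN_lt R).
rewrite natrND !natrNM natr_small -(ltr_pdivlMr _ _ (natrN_gt0 R D0)) mulrDl -mulrA.
have := divr_gt0 (natrN_gt0 R a0) (natrN_gt0 R D0).
have := divr_gt0 (natrN_gt0 R b0) (natrN_gt0 R D0).
move: pa pb; rewrite !natr_small divr1.
set x := natr R a / _; set y := natr R b / _ => pa pb y0 x0 h.
have ha : x <= expR (- (248 / 381) * ln 2) by exact: expR_ge_of_pow pa.
have hb : y <= expR (- (248 / 381) * ln (2 / 5)).
  by apply: expR_ge_of_pow pb => //; rewrite divr_gt0.
by rewrite /phi; lra.
Qed.

(** The opposite certificate: the powers are taken of inverses, so that [a / D] and [b / D] become
    upper bounds. *)
Lemma phi_le_1Dinv (S a b D e : BinNums.N) :
  (0 < S)%num -> (0 < a)%num -> (0 < b)%num -> (0 < e)%num -> (0 < D)%num ->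
  (power_up S D a 1 2 S exponent_bits <= S)%num ->
  (power_up S D b 5 2 S exponent_bits <= S)%num ->
  ((5 * a + b) * e <= 5 * D * (e + 1))%num -> phi (248 / 381) <= 1 + 1 / natr R e.
Proof.
move=> S0 a0 b0 e0 D0 pa pb.
have {}pa := @power_up_le1 R S D a 1 2 exponent_bits S0 a0 erefl pa.
have {}pb := @power_up_le1 R S D b 5 2 exponent_bits S0 b0 erefl pb.
move/(natrN_le R).
have eR := natrN_gt0 R e0; have DR := natrN_gt0 R D0.
rewrite !natrNM !natrND natrNM !natr_small => h.
have {}h : 5 * (natr R a / natr R D) + natr R b / natr R D <= 5 * (1 + 1 / natr R e).
  have -> : 1 + 1 / natr R e = (natr R e + 1) / natr R e by field; rewrite gt_eqF.
  by rewrite mulrA -mulrDl ler_pdivrMr// mulrA mulrAC ler_pdivlMr// mulrAC.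
have := divr_gt0 (natrN_gt0 R a0) DR.
have := divr_gt0 (natrN_gt0 R b0) DR.
move: pa pb h; rewrite !natr_small.
rewrite -[natr R D / natr R a]invf_div -[natr R D / natr R b]invf_div.
rewrite -[5 / 2]invf_div [1 / 2]div1r.
set x := natr R a / _; set y := natr R b / _ => pa pb h y0 x0.
have ha : expR (- (248 / 381) * ln 2) <= x by exact: expR_le_of_pow pa.
have hb : expR (- (248 / 381) * ln (2 / 5)) <= y.
  by apply: expR_le_of_pow pb => //; rewrite divr_gt0.
by rewrite /phi; lra.
Qed.

Lemma phi_root_lower : 1 < phi (248 / 381).
Proof.
(* The two powers times [10 ^ 12], rounded down; the upper bound below uses them rounded up. *)
by apply: (@phi_gt1 (10 ^ 18) 636874654981 1815626727663 (10 ^ 12)); vm_compute.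
Qed.

Lemma phi_root_near : phi (248 / 381) <= 1 + 1 / 10 ^+ 8.
Proof.
have -> : 10 ^+ 8 = natr R (100 * 100 * 100 * 100).
  by have n100 : natr R 100 = 100 by []; rewrite !natrNM n100; ring.
by apply: (@phi_le_1Dinv (10 ^ 18) 636874654982 1815626727664 (10 ^ 12)); vm_compute.
Qed.

(** The point 2/3 beyond the root is the right end of the chords in the convexity arguments. *)
Lemma phi_two_thirds : phi (2 / 3) <= 999 / 1000.
Proof.
have ha : expR (- (2 / 3) * ln 2) <= 63 / 100 :> R.
  by apply: expR_le_of_pow; [by []| | |rewrite !invf_div]; lra.
have hb : expR (- (2 / 3) * ln (2 / 5)) <= 369 / 200 :> R.
  by apply: expR_le_of_pow; [by []| | |rewrite !invf_div]; lra.
by rewrite /phi; lra.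
Qed.

(** Intermediate values on [[248/381, hi]]: the chord of [phi] from 248/381 to 2/3 has already
    dropped below 1 at [hi]. *)
Lemma exists_phi_root : exists2 eta : R, phi eta = 1 &
  `|eta - (650 / 10 ^+ 3 + 919 / 10 ^+ 6)| <= 5 / 10 ^+ 7.
Proof.
pose hi : R := 650 / 10 ^+ 3 + 919 / 10 ^+ 6 + 5 / 10 ^+ 7.
(* [hi] lies between 248/381 and 2/3, whose difference is 2/127. *)
pose t : R := (2 / 3 - hi) * (127 / 2).
have phi_hi : phi hi < 1.
  have -> : hi = t * (248 / 381) + (1 - t) * (2 / 3) by rewrite /t; field.
  have t01 : 0 <= t <= 1 by rewrite /t /hi; lra.
  apply: le_lt_trans (phi_convex _ _ t01) _.
  have := phi_root_near; have := phi_two_thirds.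
  (* Weight [10 ^ -5] on the drop [10 ^ -3] offsets the excess [10 ^ -8], which is itself scaled by
     [t < 1]. *)
  have : 1 - t >= 1 / 10 ^+ 5 by rewrite /t /hi; lra.
  move: t01; set x := phi _; set y := phi _; nra.
have lo_hi : 248 / 381 <= hi by rewrite /hi; lra.
have [||c] := @IVT R phi (248 / 381) hi 1 lo_hi.
- by apply: continuous_subspaceT; exact: continuous_phi.
- by rewrite ge_min le_max (ltW phi_hi) (ltW phi_root_lower) orbT.
rewrite in_itv /= /hi => /andP[c1 c2] pc; exists c => //.
by rewrite ler_norml; apply/andP; split; lra.
Qed.

End Root.

(** * The maximum of [f5BP] *)

Section Maximum.
Variables (R : realType) (eta : R).
Hypothesis phi_eta : phi eta = 1.
Hypothesis eta_bounds : 1 / 2 < eta < 2 / 3.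

Lemma phi_lt1 (l : R) : eta < l -> l < 2 / 3 -> phi l < 1.
Proof.
move=> el l23; pose t := (2 / 3 - l) / (2 / 3 - eta).
have e0 : 0 < 2 / 3 - eta by move: eta_bounds; lra.
have t1 : t < 1 by rewrite /t ltr_pdivrMr// mul1r; lra.
have t0 : 0 <= t by rewrite /t divr_ge0 ?ltW// subr_gt0.
have -> : l = t * eta + (1 - t) * (2 / 3).
  by rewrite /t; field; rewrite gt_eqF//; lra.
apply: le_lt_trans (phi_convex _ _ _) _; first by rewrite t0 ltW.
have := phi_two_thirds R; rewrite phi_eta; nra.
Qed.

(** With [tilt_true], the mean offspring numbers reweighted by [exp (- eta * displacement)]. They
    form a probability because [phi eta = 1], and [drift] is the mean displacement under it. *)
Definition tilt_false : R := expR (- eta * ln 2).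
Definition tilt_true : R := 1 / 5 * expR (- eta * ln (2 / 5)).
Definition drift : R := tilt_false * ln 2 + tilt_true * ln (2 / 5).

Lemma tilt_sum : tilt_false + tilt_true = 1.
Proof. exact: phi_eta. Qed.

Lemma ln2_gt0 : 0 < ln (2 : R).
Proof. by rewrite ln_gt0// ltr1n. Qed.

Lemma ln25_lt0 : ln (2 / 5 : R) < 0.
Proof. by apply: ln_lt0; apply/andP; split; lra. Qed.

Lemma ln25_gt : - (3 / 2) * ln 2 < ln (2 / 5 : R).
Proof.
(* Twice the claim, exponentiated: [(2/5) ^ 2 * 2 ^ 3 = 32/25 > 1]. *)
have : 0 < ln (32 / 25 : R) by rewrite ln_gt0//; lra.
have -> : 32 / 25 = (2 / 5) ^+ 2 * 2 ^+ 3 :> R by field.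
rewrite lnM ?posrE ?exprn_gt0//; try lra.
by rewrite !lnXn//; lra.
Qed.

(** At weight 3/5, steps [ln 2] and [- (3/2) * ln 2] have mean zero; this is the threshold for
    [drift_gt0]. *)
Lemma tilt_false_gt : 3 / 5 < tilt_false.
Proof.
have h : 62 / 100 <= expR (- (2 / 3) * ln 2) :> R.
  by apply: expR_ge_of_pow; [by []| | |]; lra.
have : expR (- (2 / 3) * ln 2) < tilt_false.
  by rewrite ltr_expR ltr_pM2r ?ln2_gt0// ltrN2; case/andP: eta_bounds.
move: h; lra.
Qed.

(** At weight 5/6, the untilted proportion of first children, the mean step is exactly
    [1/6 * ln (64/5)]. *)
Lemma tilt_false_lt : tilt_false < 5 / 6.
Proof.
have h : expR (- (1 / 2) * ln 2) <= 8 / 10 :> R.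
  by apply: (@expR_le_of_pow _ _ _ 2 1); [by []| | |rewrite !invf_div]; lra.
have : tilt_false < expR (- (1 / 2) * ln 2).
  by rewrite ltr_expR ltr_pM2r ?ln2_gt0// ltrN2; case/andP: eta_bounds.
move: h; lra.
Qed.

Lemma drift_gt0 : 0 < drift.
Proof.
rewrite /drift.
have := tilt_sum; have := tilt_false_gt; have := ln25_gt; have := ln2_gt0.
have := tilt_false_lt; set p := tilt_false; set q := tilt_true.
set x := ln 2; set y := ln (2 / 5) => *.
have : 0 < (1 - p) * (y + 3 / 2 * x) by apply: mulr_gt0; lra.
have : 0 < x * (p - 3 / 5) by apply: mulr_gt0; lra.
have -> : q = 1 - p by lra.
nra.
Qed.

Lemma drift_lt : drift < 1 / 6 * ln (64 / 5).
Proof.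
have -> : 64 / 5 = 2 ^+ 5 * (2 / 5) :> R by field.
rewrite lnM ?posrE ?exprn_gt0//; try lra.
rewrite lnXn//.
rewrite /drift.
have := tilt_sum; have := tilt_false_lt; have := ln25_lt0; have := ln2_gt0.
set p := tilt_false; set q := tilt_true.
set x := ln 2; set y := ln (2 / 5) => *.
have : 0 < (5 / 6 - p) * (x - y) by apply: mulr_gt0; lra.
have -> : q = 1 - p by lra.
nra.
Qed.

(** The ratio of the two sides is a mean, under the tilted law, of exponentials of a centred
    variable. By [1 + x <= expR x] it is at least 1, the linear terms cancelling. *)
Lemma phi_tangent (l : R) : expR (drift * (eta - l)) <= phi l.
Proof.
have h : 1 <= phi l * expR (- (drift * (eta - l))).
  have -> : phi l * expR (- (drift * (eta - l))) =
      tilt_false * expR ((drift - ln 2) * (l - eta)) +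
      tilt_true * expR ((drift - ln (2 / 5)) * (l - eta)).
    rewrite /phi /tilt_false /tilt_true mulrDl -!(mulrA (1 / 5)) -!expRD.
    by congr (expR _ + _ * expR _); ring.
  rewrite [leLHS](_ : 1 = tilt_false * (1 + (drift - ln 2) * (l - eta)) +
                tilt_true * (1 + (drift - ln (2 / 5)) * (l - eta))); last first.
    have e : tilt_true = 1 - tilt_false by rewrite -tilt_sum; ring.
    by rewrite /drift e; ring.
  have q0 : 0 <= tilt_true by rewrite mulr_ge0 ?expR_ge0//; lra.
  by apply: lerD; rewrite ler_wpM2l ?expR_ge1Dx ?expR_ge0.
by move: h; rewrite expRN ler_pdivlMr ?expR_gt0// mul1r.
Qed.

Lemma phi_gt0 (l : R) : 0 < phi l.
Proof. exact: lt_le_trans (expR_gt0 _) (phi_tangent l). Qed.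

Let E (a : R) := [set a * theta - ln (2 `^ theta + 1 / 5 * (2 / 5) `^ theta)
        | theta in [set theta : R | theta <= 0]].

(** For [theta <= 0] the second term alone keeps [phi (- theta)] above [1/5]. Boundedness matters
    because [sup] takes a default value on unbounded sets. *)
Lemma has_sup_rate (a : R) : 0 < a -> has_sup (E a).
Proof.
move=> a0; split; first by exists (a * 0 - ln (2 `^ 0 + 1 / 5 * (2 / 5) `^ 0)), 0 => /=.
exists (ln 5) => _ [theta /= t0 <-]; rewrite phi_powR.
have : ln (1 / 5) <= ln (phi (- theta)).
  rewrite ler_ln ?posrE ?phi_gt0 ?divr_gt0//.
  rewrite /phi opprK.
  have := expR_ge0 (theta * ln 2).
  have : 0 <= theta * ln (2 / 5) by rewrite mulr_le0// ltW// ln25_lt0.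
  move: (expR_ge1Dx (theta * ln (2 / 5))); lra.
rewrite div1r lnV ?posrE//.
have : a * theta <= 0 by rewrite mulr_ge0_le0// ltW.
lra.
Qed.

(** The choice [theta = - eta] gives [g5BP a <= a * eta] for every [a > 0]; at [drift] the tangent
    inequality gives equality. *)
Lemma maximum_f5BP :
  is_maximum_on [set a : R | 0 < a < 1 / 6 * ln (64 / 5)] (@f5BP R) eta.
Proof.
have Eeta a : E a (- (a * eta)).
  exists (- eta); first by rewrite /= oppr_le0; move: eta_bounds; lra.
  by rewrite phi_powR opprK phi_eta ln1 subr0 mulrN.
split.
  exists drift; first by rewrite /= drift_gt0 drift_lt.
  suff e : g5BP drift = drift * eta.
    by rewrite /f5BP e mulrAC mulfV ?mul1r// gt_eqF// drift_gt0.
  rewrite /g5BP -/(E drift); apply/eqP; rewrite eqr_oppLR eq_le; apply/andP; split.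
    apply: ge_sup; first by exists (- (drift * eta)); exact: Eeta.
    move=> _ [theta /= t0 <-]; rewrite phi_powR.
    have : drift * (eta + theta) <= ln (phi (- theta)).
      rewrite -ler_expR lnK ?posrE ?phi_gt0//.
      by have := phi_tangent (- theta); rewrite opprK.
    by rewrite mulrDr; lra.
  by apply: ub_le_sup => //; case: (has_sup_rate drift_gt0).
move=> a /= /andP[a0 _]; rewrite /f5BP ler_pdivrMr// /g5BP -/(E a) lerNl.
by rewrite mulrC; apply: ub_le_sup => //; case: (has_sup_rate a0).
Qed.

End Maximum.

(** * Labels, births and counts by generation *)

Section Words.
Variable R : realType.
Implicit Types (u v p : label) (c : label -> bool).

Definition step (b : bool) : R := if b then ln (2 / 5) else ln 2.
Definition displacement u : R := \sum_(b <- u) step b.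
(** The probability that [u] is born, as [prob_born] shows. *)
Definition birth_weight u : R := \prod_(b <- u) (if b then 1 / 5 else 1).

Fixpoint words (k : nat) : seq label :=
  if k is k'.+1 then flatten [seq [:: rcons u false; rcons u true] | u <- words k']
  else [:: [::]].

(* The labels that must have two children for [p ++ u] to be born once [p] is. *)
Fixpoint needs p u : seq label :=
  if u is b :: u' then (if b then [:: p] else [::]) ++ needs (rcons p b) u'
  else [::].

Definition born c p u := all c (needs p u).

Lemma mem_words k u : (u \in words k) = (size u == k).
Proof.
elim: k u => [|k IHk] u; first by rewrite inE; case: u.
apply/idP/idP.
  move=> /flatten_mapP[v]; rewrite IHk => /eqP vk.
  by rewrite !inE => /orP[] /eqP ->; rewrite size_rcons vk.
case/lastP: u => [//|u b]; rewrite size_rcons eqSS -IHk => uk.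
by apply/flatten_mapP; exists u => //; rewrite !inE; case: b; rewrite eqxx ?orbT.
Qed.

Lemma uniq_words k : uniq (words k).
Proof.
elim: k => [//|k] /=; elim: (words k) => [//|u s IHs] /= /andP[us Us].
have out b : rcons u b \notin flatten [seq [:: rcons w false; rcons w true] | w <- s].
  apply/negP => /flatten_mapP[w ws]; rewrite !inE !eqseq_rcons.
  by move=> /orP[] /andP[/eqP uw _]; move: us; rewrite uw ws.
by rewrite IHs// inE eqseq_rcons andbF /= !out.
Qed.

Lemma sum_words (V : nmodType) (F : label -> V) k :
  \sum_(u <- words k.+1) F u = \sum_(u <- words k) (F (rcons u false) + F (rcons u true)).
Proof.
rewrite /= big_flatten /= big_map; apply: eq_bigr => u _.
by rewrite !big_cons big_nil addr0.
Qed.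

Lemma sum_words_prod (h : bool -> R) k :
  \sum_(u <- words k) \prod_(b <- u) h b = (h false + h true) ^+ k.
Proof.
elim: k => [|k IHk]; first by rewrite big_seq1 big_nil expr0.
rewrite sum_words exprSr -IHk mulr_suml; apply: eq_bigr => u _.
by rewrite -!cats1 !big_cat !big_seq1 -mulrDr.
Qed.

Lemma displacement_rcons u b : displacement (rcons u b) = displacement u + step b.
Proof. by rewrite /displacement -cats1 big_cat big_seq1. Qed.

Lemma displacement_cat u v : displacement (u ++ v) = displacement u + displacement v.
Proof. by rewrite /displacement big_cat. Qed.

Lemma birth_weight_cat u v : birth_weight (u ++ v) = birth_weight u * birth_weight v.
Proof. by rewrite /birth_weight big_cat. Qed.

Lemma birth_weight_ge0 u : 0 <= birth_weight u.
Proof. by apply: prodr_ge0 => -[] _ //; lra. Qed.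

Lemma needs_cat p u v : needs p (u ++ v) = needs p u ++ needs (p ++ u) v.
Proof.
elim: u p => [|b u IHu] p /=; first by rewrite cats0.
by rewrite IHu catA cat_rcons.
Qed.

(** Hence disjoint subtrees read disjoint labels, the source of all independence below. *)
Lemma needs_prefix p u v : v \in needs p u -> prefix p v.
Proof.
elim: u p => [//|b u IHu] p /=; rewrite mem_cat => /orP[|/IHu].
  by case: b => //; rewrite inE => /eqP ->; exact: prefix_refl.
exact/prefix_trans/prefix_rcons.
Qed.

Lemma uniq_needs p u : uniq (needs p u).
Proof.
elim: u p => [//|b u IHu] p /=; rewrite cat_uniq IHu andbT.
case: b => /=; last by apply/hasPn.
apply/hasPn => v /needs_prefix /size_prefix.
rewrite size_rcons inE => pv; apply/eqP => vp.
by move: pv; rewrite vp ltnn.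
Qed.

Lemma prod_needs p u : \prod_(v <- needs p u) (1 / 5) = birth_weight u.
Proof.
elim: u p => [|b u IHu] p; first by rewrite /birth_weight !big_nil.
by rewrite /= big_cat IHu /birth_weight big_cons; case: b; rewrite ?big_seq1 ?big_nil.
Qed.

Lemma born_cat c p u v : born c p (u ++ v) = born c p u && born c (p ++ u) v.
Proof. by rewrite /born needs_cat all_cat. Qed.

Variables (start : R) (c : label -> bool).

(** The random generation becomes a filter of a fixed list, so that expectations are sums over fixed
    words. *)
Lemma generationE k : generation start c k =
  [seq (u, start + displacement u) | u <- words k & born c [::] u].
Proof.
elim: k => [|k IHk] /=; first by rewrite /displacement big_nil addr0.
rewrite IHk; elim: (words k) => [//|u s IHs] /=.
have e b : born c [::] (rcons u b) = born c [::] u && (b ==> c u).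
  by rewrite -cats1 born_cat /born; case: b; rewrite /= ?andbT.
rewrite !e andbT; case: (born c [::] u) => /=; last by rewrite IHs.
by rewrite IHs -!addrA; case: (c u); rewrite /= !displacement_rcons.
Qed.

Definition low_count (k : nat) (x : R) : nat :=
  count (fun u => born c [::] u && (expR (start + displacement u) <= x)) (words k).

Lemma count_Z k x :
  count (fun i => Defs.Z start c k i <= x) (iota 0 (Defs.N start c k)) = low_count k x.
Proof.
have -> : low_count k x = count (fun v : individual R => expR v.2 <= x) (generation start c k).
  by rewrite generationE count_map count_filter; apply: eq_count => u /=; rewrite andbC.
rewrite -[in RHS](mkseq_nth ([::], 0) (generation start c k)) /mkseq count_map.
exact: eq_count.
Qed.

Definition low_indices k x : seq (nat * nat) :=
  [seq (k, i) | i <- iota 0 (Defs.N start c k) & Defs.Z start c k i <= x].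

Lemma size_low_indices k x : size (low_indices k x) = low_count k x.
Proof. by rewrite size_map size_filter count_Z. Qed.

Lemma mem_low_indices k x ki : (ki \in low_indices k x) =
  [&& ki.1 == k, (ki.2 < Defs.N start c k)%N & Defs.Z start c k ki.2 <= x].
Proof.
case: ki => l i /=; apply/mapP/and3P => [[j]|[/eqP -> iN Zx]].
  by rewrite mem_filter mem_iota add0n => /andP[? ?] [-> ->].
by exists i => //; rewrite mem_filter mem_iota Zx.
Qed.

Lemma counting_seq (I : choiceType) (l : seq I) : uniq l ->
  counting [set` l] = (size l)%:R%:E :> \bar R.
Proof.
move=> Ul; rewrite /counting asboolT//.
have -> : fset_set [set` l] = [fset x in l]%fset.
  by apply/fsetP => x; rewrite in_fset_set// inE /= mem_setE.
by rewrite card_fseq undup_id.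
Qed.

Lemma le_counting (I : choiceType) (A B : set I) : A `<=` B ->
  (counting A <= counting B :> \bar R)%E.
Proof.
move=> AB; rewrite {2}/counting; case: asboolP => fB; last exact: leey.
have fA := sub_finite_set AB fB.
rewrite /counting asboolT// lee_fin ler_nat; apply: fsubset_leq_card.
by apply/fsubsetP => x; rewrite !in_fset_set// !inE; exact: AB.
Qed.

Lemma Istar_ge k x : (1 <= k)%N -> ((low_count k x)%:R%:E <= Istar start c x)%E.
Proof.
move=> k1; rewrite -size_low_indices -counting_seq; last first.
  by rewrite map_inj_uniq ?filter_uniq ?iota_uniq// => i j [].
apply: le_counting => -[l i] /=; rewrite mem_low_indices => /and3P[/eqP/= -> iN Zx].
by split.
Qed.

(** Only an upper bound, since the sum contains generation 0, which [Istar] leaves out. *)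
Lemma Istar_finite k0 x : (forall k, (k0 <= k)%N -> low_count k x = 0%N) ->
  (Istar start c x <= (\sum_(k < k0) low_count k x)%:R%:E)%E.
Proof.
move=> low0; pose l := flatten [seq low_indices k x | k <- iota 0 k0].
have Ul : uniq l.
  apply: allpairs_uniq_dep; first exact: iota_uniq.
    by move=> k _; rewrite filter_uniq ?iota_uniq.
  by move=> [k i] [k' i'] _ _ /= [-> ->].
have -> : (\sum_(k < k0) low_count k x = size l)%N.
  rewrite size_flatten /shape -map_comp sumnE big_map -[in RHS](subn0 k0).
  by rewrite -/(index_iota 0 k0) big_mkord; apply: eq_bigr => k _ /=; rewrite size_low_indices.
rewrite -counting_seq//; apply: le_counting => -[k i] [/= _ iN Zx].
apply/flatten_mapP; exists k; last by rewrite mem_low_indices eqxx iN.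
rewrite mem_iota /= add0n ltnNge; apply/negP => /low0 /eqP.
rewrite -size_low_indices size_eq0 => /eqP e0.
by have := mem_low_indices k x (k, i); rewrite e0 in_nil /= eqxx iN Zx.
Qed.

End Words.

(** * Events determined by finitely many labels *)

Section FiniteEvents.
Variables (R : realType) (d : measure_display) (T : measurableType d).
Variables (P : probability T R) (two : label -> {RV P >-> bool}).
Hypotheses (two_law : reproduction_law two) (two_indep : mutually_independent two).

Implicit Types (e f : pred (label -> bool)) (c : label -> bool) (s : seq label).

Definition config (omega : T) : label -> bool := fun u => two u omega.
Definition event e : set T := [set omega | e (config omega)].
Definition prob e : R := fine (P (event e)).

(** Stands for measurability with respect to the variables at the labels in [s]. *)
Definition depends s e := forall c c', {in s, c =1 c'} -> e c = e c'.

Definition update c (u : label) (b : bool) : label -> bool :=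
  fun v => if v == u then b else c v.

Lemma depends_sub s s' e : {subset s <= s'} -> depends s e -> depends s' e.
Proof. by move=> ss' de c c' cc'; apply: de => u /ss'; exact: cc'. Qed.

Lemma depends_update u s e b : depends (u :: s) e ->
  depends s (fun c => e (update c u b)).
Proof.
move=> de c c' cc'; apply: de => v; rewrite inE /update.
by case: eqVneq => //= _; exact: cc'.
Qed.

(** Fixing the variable at [u] leaves an event that depends on one label fewer; the inductions on
    label sets rest on this. *)
Lemma event_split u e (A : set T) : A `&` event e =
  (A `&` two u @^-1` [set true] `&` event (fun c => e (update c u true))) `|`
  (A `&` two u @^-1` [set false] `&` event (fun c => e (update c u false))).
Proof.
have upd omega b : two u omega = b -> update (config omega) u b = config omega.
  by move=> ub; apply/funext => v; rewrite /update; case: eqP => // ->.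
apply/seteqP; split=> omega.
  move=> [Ao eo]; case ub: (two u omega); [left|right];
    by split; [split | rewrite /event /= upd].
by move=> [] [[Ao /upd h]]; rewrite /event /= h.
Qed.

Lemma measurable_two u (A : set bool) : measurable (two u @^-1` A).
Proof. exact: measurable_funPTI. Qed.

Lemma depends_nil e : depends [::] e -> event e = set0 \/ event e = setT.
Proof.
move=> de; case: (pselect (exists omega, event e omega)) => [[w ew]|ne].
  by right; apply/seteqP; split=> // v _; rewrite /event /= (de _ (config w)).
by left; apply/seteqP; split=> // w ew; apply: ne; exists w.
Qed.

Lemma measurable_event s e : depends s e -> measurable (event e).
Proof.
elim: s e => [|u s IHs] e de.
  by case: (depends_nil de) => ->.
rewrite -(setTI (event e)) (event_split u); apply: measurableU;
  apply: measurableI; rewrite ?setTI; do ?exact: measurable_two;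
  exact/IHs/depends_update.
Qed.

Definition cylinder s c : set T := \bigcap_(u in [set` s]) (two u @^-1` [set c u]).

Lemma measurable_cylinder s c : measurable (cylinder s c).
Proof. by apply: fin_bigcap_measurable => // u _; exact: measurable_two. Qed.

Lemma cylinder_update s c u b : u \notin s ->
  cylinder s c `&` two u @^-1` [set b] = cylinder (u :: s) (update c u b).
Proof.
move=> us; apply/seteqP; split=> omega.
  move=> [co ub] v /=; rewrite inE /update; case: eqP => [-> _|_ /= vs]; first exact: ub.
  exact: co.
move=> co; split.
  move=> v /= vs; have := co v; rewrite /= inE vs orbT => /(_ isT).
  by rewrite /update; case: eqP => // vu; move: us; rewrite -vu vs.
by have := co u; rewrite /= inE eqxx /update eqxx => /(_ isT).
Qed.

Lemma prob_cylinder s c : uniq s ->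
  P (cylinder s c) = (\prod_(u <- s) P (two u @^-1` [set c u]))%E.
Proof. exact: (two_indep (fun u => [set c u])). Qed.

Lemma indep_cylinders s s' c c' : uniq s -> uniq s' ->
  (forall u, u \in s -> u \notin s') ->
  P (cylinder s c `&` cylinder s' c') = (P (cylinder s c) * P (cylinder s' c'))%E.
Proof.
move=> Us Us' ss'; pose m u := if u \in s then c u else c' u.
have Em u : u \in s -> m u = c u by rewrite /m => ->.
have Em' u : u \in s' -> m u = c' u.
  by rewrite /m; case: ifP => // /ss' /negbTE ->.
have -> : cylinder s c `&` cylinder s' c' = cylinder (s ++ s') m.
  apply/seteqP; split=> omega.
    move=> [h h'] u /=; rewrite mem_cat => /orP[us|us].
      by rewrite Em//; exact: h.
    by rewrite Em'//; exact: h'.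
  move=> h; split=> u /= us.
    by have := h u; rewrite /= mem_cat us Em//; exact.
  by have := h u; rewrite /= mem_cat us orbT Em'//; exact.
rewrite !prob_cylinder//; last first.
  by rewrite cat_uniq Us Us' andbT /=; apply/hasPn => u us'; apply/negP => /ss'; rewrite us'.
rewrite big_cat /=; congr (_ * _)%E; apply: eq_big_seq => u us.
  by rewrite Em.
by rewrite Em'.
Qed.

(** Independence from cylinders passes to general events: the labels of [s] move one by one into the
    cylinder, and the two disjoint halves are added. *)
Lemma indep_cylinder_event (G : set T) (S s s0 : seq label) c0 e :
  measurable G ->
  (forall s' c, uniq s' -> {subset s' <= S} ->
    P (G `&` cylinder s' c) = (P G * P (cylinder s' c))%E) ->
  uniq (s0 ++ s) -> {subset s0 ++ s <= S} -> depends s e ->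
  P (G `&` (cylinder s0 c0 `&` event e)) = (P G * P (cylinder s0 c0 `&` event e))%E.
Proof.
move=> mG HG; elim: s s0 c0 e => [|u s IHs] s0 c0 e Us sS de.
  rewrite cats0 in Us sS.
  by case: (depends_nil de) => ->; rewrite ?setI0 ?setIT ?measure0 ?mule0 ?HG.
have us0 : u \notin s0.
  move: Us; rewrite cat_uniq => /and3P[_ /= + _].
  by rewrite negb_or => /andP[].
have me b : measurable (event (fun c => e (update c u b))).
  exact/measurable_event/depends_update/de.
have mC b : measurable (cylinder (u :: s0) (update c0 u b) `&`
    event (fun c => e (update c u b))).
  by apply: measurableI => //; exact: measurable_cylinder.
have dis : [disjoint cylinder (u :: s0) (update c0 u true) &
    cylinder (u :: s0) (update c0 u false)]%classic.
  apply/disj_setPS => omega [/(_ u) + /(_ u)].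
  rewrite /= inE eqxx /update eqxx /= => /(_ isT) -> /(_ isT) //.
rewrite (event_split u) !cylinder_update// setIUr !measureU//; last 4 first.
- rewrite -subset0 => omega [[h _] [h' _]].
  by move/disj_setPS: dis => /(_ omega); exact.
- exact: measurableI.
- exact: measurableI.
- rewrite -subset0 => omega [[_ [h _]] [_ [h' _]]].
  by move/disj_setPS: dis => /(_ omega); exact.
have perm : perm_eq (s0 ++ u :: s) ((u :: s0) ++ s).
  by rewrite perm_sym /= -cat1s perm_catCA.
have IH b : P (G `&` (cylinder (u :: s0) (update c0 u b) `&`
      event (fun c => e (update c u b)))) =
    (P G * P (cylinder (u :: s0) (update c0 u b) `&`
      event (fun c => e (update c u b))))%E.
  apply: IHs; [by rewrite -(perm_uniq perm)| |exact: depends_update].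
  by move=> v; rewrite -(perm_mem perm); exact: sS.
apply: eq_trans (esym (ge0_muleDr _ _ _)) => //.
by congr (_ + _)%E; exact: IH.
Qed.

Lemma probE e s : depends s e -> P (event e) = (prob e)%:E.
Proof.
by move=> de; rewrite fineK// fin_num_measure//; exact: measurable_event de.
Qed.

(** The extension from cylinders to events is applied twice: first to [e] against a fixed cylinder
    over [s2], then to [f] against [e]. *)
Lemma prob_indep s1 s2 e f : depends s1 e -> depends s2 f ->
  (forall u, u \in s1 -> u \notin s2) ->
  prob (fun c => e c && f c) = prob e * prob f.
Proof.
move=> de df s12.
have {}de : depends (undup s1) e.
  by apply: depends_sub de => u; rewrite mem_undup.
have {}df : depends (undup s2) f.
  by apply: depends_sub df => u; rewrite mem_undup.
pose c0 : label -> bool := fun=> true.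
have cyl0 : cylinder [::] c0 = setT by rewrite /cylinder set_nil bigcap_set0.
have H s c : uniq s -> {subset s <= s2} ->
    P (event e `&` cylinder s c) = (P (event e) * P (cylinder s c))%E.
  move=> Us ss2; rewrite setIC muleC -[event e]setTI -cyl0.
  apply: (@indep_cylinder_event _ s1 (undup s1)) => //.
  - exact: measurable_cylinder.
  - move=> s' c' Us' s's1; apply: indep_cylinders => // u us.
    by apply/negP => /s's1/s12; rewrite ss2.
  - exact: undup_uniq.
  - by move=> u; rewrite mem_undup.
have := @indep_cylinder_event (event e) s2 (undup s2) [::] c0 f.
rewrite cyl0 setTI => /(_ (measurable_event de) H (undup_uniq _)) h.
rewrite /prob -fineM ?fin_num_measure//; try by [exact: measurable_event de|exact: measurable_event df].
rewrite -h//; last by move=> u; rewrite mem_undup.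
by congr (fine (P _)); apply/seteqP; split=> omega /=; rewrite /event /= => /andP.
Qed.

Lemma prob_ge0 e : 0 <= prob e.
Proof. by rewrite /prob fine_ge0. Qed.

Lemma prob_compl s e : depends s e -> prob (fun c => ~~ e c) = 1 - prob e.
Proof.
move=> de; have me := measurable_event de.
have -> : prob (fun c => ~~ e c) = fine (P (~` event e)).
  by congr (fine (P _)); apply/seteqP; split=> omega /=; rewrite /event /= => /negP.
by rewrite probability_setC// (probE de).
Qed.

Lemma prob_all s : uniq s -> prob (fun c => all c s) = \prod_(u <- s) (1 / 5).
Proof.
move=> Us; rewrite /prob.
have -> : event (fun c => all c s) = cylinder s (fun=> true).
  apply/seteqP; split=> omega; first by move=> /allP h u /= us; exact: h.
  by move=> h; apply/allP => u us; exact: h.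
rewrite prob_cylinder// (eq_bigr (fun=> (1 / 5)%:E)); last first.
  by move=> u _; exact: (two_law u).2.
by rewrite prodEFin.
Qed.

Lemma depends_all s : depends s (fun c => all c s).
Proof. by move=> c c' cc'; apply: eq_in_all => u us; rewrite cc'. Qed.

Lemma prob_born p u : prob (fun c => born c p u) = birth_weight R u.
Proof. by rewrite prob_all ?uniq_needs// prod_needs. Qed.

Lemma integral_weighted_events (I : Type) (r : seq I) (a : I -> R)
    (e : I -> pred (label -> bool)) (s : I -> seq label) :
  (forall i, 0 <= a i) -> (forall i, depends (s i) (e i)) ->
  (\int[P]_omega (\sum_(i <- r) a i * (e i (config omega))%:R)%:E)%E =
  (\sum_(i <- r) a i * prob (e i))%:E.
Proof.
move=> a0 de.
have me i := measurable_event (de i).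
transitivity (\int[P]_omega (\sum_(i <- r) ((a i)%:E * (\1_(event (e i)) omega)%:E)))%E.
  apply: eq_integral => omega _; rewrite -sumEFin; apply: eq_bigr => i _.
  rewrite EFinM indicE; congr (_ * _%:R%:E)%E.
  by case: (boolP (e i _)) => h; [rewrite mem_set | rewrite memNset//; exact/negP].
rewrite ge0_integral_sum//; last 2 first.
- by move=> i; apply: measurable_funeM; apply/measurable_EFinP; exact: measurable_indic.
- by move=> i omega _; rewrite mule_ge0// lee_fin.
rewrite -sumEFin; apply: eq_bigr => i _.
have mi : measurable_fun setT (fun omega => (\1_(event (e i)) omega : R)%:E).
  by apply/measurable_EFinP; exact: measurable_indic.
rewrite ge0_integralZl// ?lee_fin// integral_indic// setIT EFinM.
by congr (_ * _)%E; exact: probE (de i).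
Qed.

(** Monotonicity of expectation, in the form that serves both Markov's inequality and
    Paley-Zygmund. *)
Lemma le_weighted_events (I J : Type) (r : seq I) (q : seq J)
    (a : I -> R) (b : J -> R)
    (e : I -> pred (label -> bool)) (f : J -> pred (label -> bool))
    (s : I -> seq label) (t : J -> seq label) :
  (forall i, 0 <= a i) -> (forall j, 0 <= b j) ->
  (forall i, depends (s i) (e i)) -> (forall j, depends (t j) (f j)) ->
  (forall c, \sum_(i <- r) a i * (e i c)%:R <= \sum_(j <- q) b j * (f j c)%:R) ->
  \sum_(i <- r) a i * prob (e i) <= \sum_(j <- q) b j * prob (f j).
Proof.
move=> a0 b0 de df ef; rewrite -lee_fin.
rewrite -(integral_weighted_events r a0 de) -(integral_weighted_events q b0 df).
have mf (K : Type) (z : seq K) (w : K -> R) (g : K -> pred (label -> bool))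
    (v : K -> seq label) : (forall i, depends (v i) (g i)) ->
    measurable_fun setT (fun omega => (\sum_(i <- z) w i * (g i (config omega))%:R)%:E).
  move=> dg; apply/measurable_EFinP; apply: measurable_sum => i.
  apply: measurable_funM => //.
  rewrite (_ : (fun omega => _) = \1_(event (g i))).
    exact/measurable_indic/(measurable_event (dg i)).
  apply/funext => omega; rewrite indicE.
  by case: (boolP (g i _)) => h; [rewrite mem_set | rewrite memNset//; exact/negP].
apply: ge0_le_integral => //; [|exact: mf|exact: mf|].
- by move=> omega _; rewrite lee_fin sumr_ge0// => i _; rewrite mulr_ge0.
- by move=> omega _; rewrite lee_fin.
Qed.

Lemma prob_forall_le (q : R) (e : nat -> pred (label -> bool)) (s : nat -> seq label) n :
  (forall j, depends (s j) (e j)) ->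
  (forall i j u, u \in s i -> u \in s j -> i = j) ->
  (forall j, prob (e j) <= q) ->
  prob (fun c => all (fun j => e j c) (iota 0 n)) <= q ^+ n.
Proof.
move=> de dis eq; have q0 : 0 <= q := le_trans (prob_ge0 (e 0%N)) (eq 0%N).
have dall m : depends (flatten [seq s j | j <- iota 0 m])
    (fun c => all (fun j => e j c) (iota 0 m)).
  move=> c c' cc'; apply: eq_in_all => j jm; apply: de => u us.
  by apply: cc'; apply/flatten_mapP; exists j.
elim: n => [|n IHn].
  rewrite expr0 /prob (_ : event _ = setT) ?probability_setT//.
  exact/seteqP.
rewrite [X in prob X](_ : _ = (fun c => all (fun j => e j c) (iota 0 n) && e n c)); last first.
  by apply/funext => c; rewrite -addn1 iotaD add0n all_cat /= andbT.
rewrite (prob_indep (dall n) (de n)); last first.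
  move=> u /flatten_mapP[j]; rewrite mem_iota add0n /= => jn uj.
  by apply/negP => /(dis _ _ _ uj) jE; move: jn; rewrite jE ltnn.
by rewrite exprSr ler_pM// prob_ge0.
Qed.

(** Borel-Cantelli with a geometric series; the null set is the limit superior of the events. *)
Lemma eventually_not (q : R) (e : nat -> pred (label -> bool)) (s : nat -> seq label) :
  (forall n, depends (s n) (e n)) -> 0 <= q < 1 ->
  (forall n, prob (e n) <= q ^+ n) ->
  {ae P, forall omega, exists n0, forall n, (n0 <= n)%N -> ~~ e n (config omega)}.
Proof.
move=> de /andP[q0 q1] eq.
have me n : measurable (event (e n)) := measurable_event (de n).
exists (lim_sup_set (fun n => event (e n))); split.
- by apply: bigcap_measurable => // k _; exact: bigcup_measurable.
- apply: lim_sup_set_cvg0 => //.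
  apply: (@le_lt_trans _ _ (\sum_(n <oo) (q ^+ n)%:E)%E).
    have h n : (P (event (e n)) <= (q ^+ n)%:E)%E by rewrite (probE (de n)) lee_fin.
    by apply: lee_nneseries => // n _; exact: h.
  apply: (@le_lt_trans _ _ (1 / (1 - q))%:E); last exact: ltry.
  apply: lime_le; first by apply: is_cvg_nneseries => n _ _; rewrite lee_fin exprn_ge0.
  apply: nearW => n; rewrite sumEFin lee_fin ler_pdivlMr ?subr_gt0//.
  rewrite mulrC big_mkord -opprB mulNr -subrX1 opprB lerBlDr lerDl.
  exact: exprn_ge0.
- move=> omega /= nh n _ /=.
  apply: contrapT => h; apply: nh; exists n => m nm.
  by apply/negP => em; apply: h; exists m.
Qed.

End FiniteEvents.

(** * The upper bound *)

Section UpperBound.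
Variables (R : realType) (d : measure_display) (T : measurableType d).
Variables (P : probability T R) (two : label -> {RV P >-> bool}).
Hypotheses (two_law : reproduction_law two) (two_indep : mutually_independent two).
Variable start : R.

Lemma exprn_small (r eps : R) : 0 <= r < 1 -> 0 < eps ->
  exists n0, forall n, (n0 <= n)%N -> r ^+ n < eps.
Proof.
move=> /andP[r0 r1] eps0.
have /cvgrPdist_lt/(_ _ eps0)[n0 _ h] : r ^+ n @[n --> \oo] --> 0.
  by apply: cvg_expr; rewrite ger0_norm.
by exists n0 => n /h /=; rewrite sub0r normrN ger0_norm// exprn_ge0.
Qed.

(** The constant absorbs the finitely many terms before [n0]. *)
Lemma geometric_dominated (y : nat -> R) (r : R) (n0 : nat) : 0 < r ->
  (forall n, 0 <= y n) -> (forall n, (n0 <= n)%N -> y n <= r ^+ n) ->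
  exists2 B : R, 0 < B & forall n, y n <= B * r ^+ n.
Proof.
move=> r0 y0 yr; exists (1 + \sum_(k < n0) y k / r ^+ k).
  by rewrite ltr_pwDl// sumr_ge0// => k _; rewrite divr_ge0// exprn_ge0// ltW.
move=> n; rewrite -ler_pdivrMr ?exprn_gt0//.
have yr0 k : 0 <= y k / r ^+ k by rewrite divr_ge0// exprn_ge0// ltW.
have [n0n|nn0] := leqP n0 n.
  rewrite (@le_trans _ _ 1)//; first by rewrite ler_pdivrMr ?exprn_gt0// mul1r yr.
  by rewrite lerDl sumr_ge0.
rewrite (bigD1 (Ordinal nn0))//= addrCA lerDl addr_ge0// sumr_ge0//.
Qed.

Definition moment (l : R) (k : nat) (c : label -> bool) : R :=
  \sum_(u <- words k) expR (- l * displacement R u) * (born c [::] u)%:R.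

Lemma moment_ge0 l k c : 0 <= moment l k c.
Proof. by apply: sumr_ge0 => u _; rewrite mulr_ge0 ?expR_ge0. Qed.

Lemma depends_born p u : depends (needs p u) (fun c => born c p u).
Proof. exact: depends_all. Qed.

Definition ancestors k := flatten [seq needs [::] u | u <- words k].

Lemma depends_moment l k c c' : {in ancestors k, c =1 c'} ->
  moment l k c = moment l k c'.
Proof.
move=> cc'; apply: eq_big_seq => u uk; congr (_ * (_ : bool)%:R).
by apply: depends_born => v vu; apply: cc'; apply/flatten_mapP; exists u.
Qed.

(** The left side is the mean of [moment l k]; the weights are products over letters, so the sum
    factorises. *)
Lemma sum_birth_moment l k :
  \sum_(u <- words k) expR (- l * displacement R u) * birth_weight R u = phi l ^+ k.
Proof.
rewrite (eq_bigr (fun u => \prod_(b <- u)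
    (expR (- l * step R b) * (if b then 1 / 5 else 1)))); last first.
  by move=> u _; rewrite big_split /= -expR_sum -mulr_sumr.
by rewrite sum_words_prod /= mulr1 /phi [1 / 5 * _]mulrC.
Qed.

Lemma moment_markov l r k : 0 < r ->
  prob two (fun c => r ^+ k <= moment l k c) <= (phi l / r) ^+ k.
Proof.
move=> r0; have rk : 0 < r ^+ k by exact: exprn_gt0.
rewrite expr_div_n ler_pdivlMr// mulrC -sum_birth_moment.
under eq_bigr do rewrite -(prob_born two_law two_indep [::]).
have := @le_weighted_events _ _ _ _ two unit label [:: tt] (words k)
  (fun=> r ^+ k) (fun u => expR (- l * displacement R u))
  (fun _ c => r ^+ k <= moment l k c) (fun u c => born c [::] u)
  (fun=> ancestors k) (needs [::]).
rewrite big_seq1; apply.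
- by move=> _; exact: ltW.
- by move=> u; exact: expR_ge0.
- by move=> _ c c' /depends_moment ->.
- exact: depends_born.
- move=> c; rewrite big_seq1 -/(moment l k c); case: (leP (r ^+ k) (moment l k c)) => h /=.
    by rewrite mulr1.
  by rewrite mulr0 moment_ge0.
Qed.

(** Each individual counted contributes at least 1 to the right side; [start] enters because
    [displacement] is measured from the root. *)
Lemma low_count_le_moment l c k x : 0 < l -> 0 < x ->
  (low_count start c k x)%:R <= expR (l * (ln x - start)) * moment l k c.
Proof.
move=> l0 x0; rewrite /low_count -sum1_count big_mkcond natr_sum mulr_sumr.
apply: ler_sum => u _; case: (born c [::] u) => /=; last first.
  by rewrite !mulr0.
rewrite mulr1 -expRD; case: ifP => [|_]; last exact: expR_ge0.
rewrite -ler_ln ?posrE ?expR_gt0// expRK => h.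
rewrite -[leLHS]expR0 ler_expR; nra.
Qed.

Lemma Istar_upper l : 0 < l -> phi l < 1 ->
  {ae P, forall omega, exists2 C : R, 0 < C &
    forall x, 1 <= x -> (Istar start (config two omega) x <= (C * x `^ l)%:E)%E}.
Proof.
(* With [r] between [phi l] and 1, [phi l / r < 1] serves Borel-Cantelli and [r < 1] makes the
   moments summable. *)
move=> l0 phi1; pose r := (1 + phi l) / 2.
have phi0 : 0 < phi l.
  by rewrite addr_gt0 ?mulr_gt0 ?expR_gt0//; lra.
have r0 : 0 < r by rewrite /r; lra.
have r1 : r < 1 by rewrite /r; lra.
have qr : 0 <= phi l / r < 1.
  by rewrite divr_ge0 ?ltW//= ltr_pdivrMr// mul1r /r; lra.
have dm k : depends (ancestors k) (fun c => r ^+ k <= moment l k c).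
  by move=> c c' /depends_moment ->.
have := eventually_not dm qr (fun k => moment_markov l k r0).
apply: filterS => omega [n0 hn0]; set c := config two omega.
have [B B0 hB] : exists2 B : R, 0 < B & forall k, moment l k c <= B * r ^+ k.
  apply: (@geometric_dominated _ _ n0) => // k; first exact: moment_ge0.
  by move=> /hn0; rewrite -ltNge => /ltW.
exists (B / (1 - r) * expR (- l * start)).
  by rewrite mulr_gt0 ?expR_gt0// divr_gt0// subr_gt0.
move=> x x1; have x0 : 0 < x by exact: lt_le_trans x1.
set D := expR (l * (ln x - start)); have D0 : 0 < D by exact: expR_gt0.
have low k : (low_count start c k x)%:R <= D * (B * r ^+ k).
  by apply: le_trans (low_count_le_moment _ _ l0 x0) _; rewrite ler_pM2l.
(* From [k0] on the bound is below 1, so the integer counts vanish. [k0] depends on [x], but the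
   full geometric series bounds every partial sum. *)
have [|k0 hk0] := @exprn_small r (1 / (D * B)) _ (divr_gt0 ltr01 (mulr_gt0 D0 B0)).
  by rewrite ltW.
apply: (@le_trans _ _ (\sum_(k < k0) low_count start c k x)%:R%:E).
  apply: Istar_finite => k /hk0 h; apply/eqP; rewrite -leqn0 -ltnS -(ltr_nat R).
  by apply: le_lt_trans (low k) _; rewrite mulrA mulrC -ltr_pdivlMr ?mulr_gt0.
rewrite lee_fin natr_sum.
have -> : B / (1 - r) * expR (- l * start) * x `^ l = D * B / (1 - r).
  rewrite /D /powR gt_eqF// mulrBr expRD mulNr; ring.
apply: (@le_trans _ _ (\sum_(k < k0) D * (B * r ^+ k))); first exact: ler_sum.
rewrite -mulr_sumr -mulr_sumr mulrA ler_pM2l ?mulr_gt0// -div1r.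
rewrite ler_pdivlMr ?subr_gt0// mulrC -opprB mulNr -subrX1 opprB.
by rewrite lerBlDr lerDl exprn_ge0// ltW.
Qed.

End UpperBound.

(** * Blocks of generations with a large mean number of low descendants *)

Section GoodBlocks.
Variables (R : realType) (eta : R).
Hypothesis phi_eta : phi eta = 1.
Hypothesis eta_bounds : 1 / 2 < eta < 2 / 3.

Local Notation a := (drift eta).
Local Notation disp := (displacement R).

Definition tilted (u : label) : R := expR (- eta * disp u) * birth_weight R u.

Lemma tilted_ge0 u : 0 <= tilted u.
Proof. by rewrite mulr_ge0 ?expR_ge0 ?birth_weight_ge0. Qed.

Lemma tilted_rcons u b :
  tilted (rcons u b) = tilted u * (if b then tilt_true eta else tilt_false eta).
Proof.
rewrite /tilted displacement_rcons -cats1 birth_weight_cat mulrDr expRD.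
rewrite /birth_weight big_seq1 /tilt_true /tilt_false /step.
by case: b; ring.
Qed.

Lemma sum_tilted k : \sum_(u <- words k) tilted u = 1.
Proof. by rewrite sum_birth_moment phi_eta expr1n. Qed.

Let v := tilt_false eta * (ln 2 - a) ^+ 2 + tilt_true eta * (ln (2 / 5) - a) ^+ 2.

(** Variances of independent steps add: the cross term vanishes because [drift] is the mean step. *)
Lemma tilted_variance k :
  \sum_(u <- words k) tilted u * (disp u - k%:R * a) ^+ 2 = k%:R * v.
Proof.
elim: k => [|k IHk].
  by rewrite big_seq1 /displacement big_nil !mul0r subr0 expr0n mulr0.
have -> : k.+1%:R * v = k%:R * v + (\sum_(u <- words k) tilted u) * v.
  by rewrite sum_tilted -natr1; ring.
rewrite sum_words -IHk mulr_suml -big_split; apply: eq_bigr => u _ /=.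
rewrite !tilted_rcons !displacement_rcons /step /v -natr1.
have e : tilt_true eta = 1 - tilt_false eta by rewrite -(tilt_sum phi_eta); ring.
by rewrite /drift e; ring.
Qed.

Lemma tilted_chebyshev (delta : R) k : 0 < delta -> (0 < k)%N ->
  2 * v <= delta ^+ 2 * k%:R ->
  1 / 2 <= \sum_(u <- words k | `|disp u - k%:R * a| <= delta * k%:R) tilted u.
Proof.
move=> d0 k0 hv; have kR : 0 < k%:R :> R by rewrite ltr0n.
have := sum_tilted k.
rewrite (bigID (fun u => `|disp u - k%:R * a| <= delta * k%:R)) /=.
set A := \sum_(_ <- _ | _) _; set B := \sum_(_ <- _ | _) _ => AB.
have : (delta * k%:R) ^+ 2 * B <= k%:R * v.
  rewrite -tilted_variance mulr_sumr big_mkcond /=; apply: ler_sum => u _.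
  case: ifP => [|_]; last by rewrite mulr_ge0 ?tilted_ge0 ?sqr_ge0.
  rewrite -ltNge => h; rewrite mulrC; apply: ler_wpM2l; first exact: tilted_ge0.
  have dk : 0 <= delta * k%:R by rewrite ltW// mulr_gt0.
  by rewrite -[leRHS]real_normK ?num_real// ler_sqr ?nnegrE ?(ltW h).
have -> : A = 1 - B by lra.
have -> : (delta * k%:R) ^+ 2 * B = k%:R * (delta ^+ 2 * k%:R * B) by ring.
rewrite ler_pM2l// => h.
have dk : 0 < delta ^+ 2 * k%:R by rewrite mulr_gt0 ?exprn_gt0.
have : delta ^+ 2 * k%:R * B <= delta ^+ 2 * k%:R * (1 / 2).
  by move: h hv; set X := _ * k%:R; set Y := X * B; lra.
rewrite ler_pM2l//; lra.
Qed.

Lemma good_block (eps : R) : 0 < eps < eta ->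
  exists (K : nat) (g : seq label) (D : R),
    [/\ uniq g, {in g, forall u, size u = K},
        {in g, forall u, disp u <= D} /\ 0 <= D,
        1 < \sum_(u <- g) birth_weight R u
      & (eta - eps) * (D + ln 2) < ln (\sum_(u <- g) birth_weight R u)].
Proof.
move=> /andP[e0 eeta]; have a0 : 0 < a := drift_gt0 phi_eta eta_bounds.
pose delta := eps * a / 2; have d0 : 0 < delta by rewrite /delta divr_gt0// mulr_gt0.
(* Net gain per generation: growth rate at the low end of the window minus the required exponent
   times the position at its high end. *)
pose kappa := eta * (a - delta) - (eta - eps) * (a + delta).
have kappa0 : 0 < kappa.
  have -> : kappa = eps * a * (1 - eta) + eps * delta by rewrite /kappa /delta; field.
  by rewrite addr_gt0 ?mulr_gt0//; move: eta_bounds; lra.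
have ln20 := ln2_gt0 R.
(* The terms secure [K > 0], Chebyshev's condition and [kappa * K > 2 * ln 2]: one [ln 2] pays for
   the mass 1/2, the other for the spine. *)
pose bound := 1 + 2 * `|v| / delta ^+ 2 + 2 * ln 2 / kappa.
have b1 : 0 <= 2 * `|v| / delta ^+ 2 by rewrite divr_ge0 ?sqr_ge0// mulr_ge0.
have b2 : 0 <= 2 * ln 2 / kappa by apply: divr_ge0; [apply: mulr_ge0 => //|]; exact: ltW.
have bound0 : 0 <= bound by rewrite /bound; lra.
pose K := Num.Def.archi_bound bound.
have hK : bound < K%:R by exact: archi_boundP.
have K0 : (0 < K)%N by rewrite -(ltr_nat R); move: hK; rewrite /bound; lra.
have KR : 0 < K%:R :> R by rewrite ltr0n.
have hv : 2 * v <= delta ^+ 2 * K%:R.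
  apply: (@le_trans _ _ (2 * `|v|)); first by rewrite ler_pM2l// ler_norm.
  by rewrite [leRHS]mulrC -ler_pdivrMr ?exprn_gt0//; move: hK; rewrite /bound; lra.
have hk : 2 * ln 2 < kappa * K%:R.
  by rewrite [ltRHS]mulrC -ltr_pdivrMr//; move: hK; rewrite /bound; lra.
pose g := [seq u <- words K | `|disp u - K%:R * a| <= delta * K%:R].
pose mu := \sum_(u <- g) birth_weight R u.
have mem_g u : u \in g -> size u = K /\ `|disp u - K%:R * a| <= delta * K%:R.
  by rewrite mem_filter mem_words => /andP[-> /eqP].
have half : expR (eta * (a - delta) * K%:R) <= 2 * mu.
  have := tilted_chebyshev d0 K0 hv; rewrite -big_filter -/g => h.
  (* Undoing the tilt: on [g] the displacement is at least [(a - delta) * K]. *)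
  have : \sum_(u <- g) tilted u <= expR (- (eta * (a - delta) * K%:R)) * mu.
    rewrite mulr_sumr big_seq [leRHS]big_seq; apply: ler_sum => u /mem_g[_].
    rewrite ler_norml => /andP[h1 _].
    apply: ler_wpM2r; first exact: birth_weight_ge0.
    rewrite ler_expR mulNr lerN2 -mulrA ler_pM2l; last by move: eta_bounds; lra.
    by move: h1; rewrite mulrBl; lra.
  rewrite expRN; set X := expR _; have X0 : 0 < X by exact: expR_gt0.
  move=> h'; have := le_trans h h'.
  by rewrite ler_pdivlMl//; lra.
have mu0 : 0 < mu by have := lt_le_trans (expR_gt0 _) half; lra.
have lnmu : (eta - eps) * ((a + delta) * K%:R + ln 2) < ln mu.
  have : eta * (a - delta) * K%:R <= ln 2 + ln mu.
    by rewrite -lnM ?posrE// -ler_expR lnK ?posrE// mulr_gt0.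
  move: hk; rewrite /kappa.
  have : (eta - eps) * ln 2 < 1 * ln 2.
    by rewrite ltr_pM2r//; move: eta_bounds; lra.
  move=> *; nra.
have D0 : 0 <= (a + delta) * K%:R by apply: mulr_ge0; lra.
exists K, g, ((a + delta) * K%:R); split=> //.
- by rewrite filter_uniq ?uniq_words.
- by move=> u /mem_g[].
- by split=> // u /mem_g[_]; rewrite ler_norml mulrDl => /andP[_]; lra.
rewrite ltNge; apply/negP => /ln_le0 h.
have : 0 <= (eta - eps) * ((a + delta) * K%:R + ln 2).
  by apply: mulr_ge0; lra.
move: lnmu; rewrite -/mu in h; lra.
Qed.

End GoodBlocks.

(** * The second moment of the block process and the lower bound *)

Section SecondMoment.
Variables (R : realType) (d : measure_display) (T : measurableType d).
Variables (P : probability T R) (two : label -> {RV P >-> bool}).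
Hypotheses (two_law : reproduction_law two) (two_indep : mutually_independent two).

Lemma prob_le s s' (e f : pred (label -> bool)) :
  depends s e -> depends s' f -> (forall c, e c -> f c) -> prob two e <= prob two f.
Proof.
move=> de df ef.
have := @le_weighted_events _ _ _ _ two unit unit [:: tt] [:: tt]
  (fun=> 1) (fun=> 1) (fun=> e) (fun=> f) (fun=> s) (fun=> s').
rewrite !big_seq1 !mul1r; apply => // c; rewrite !big_seq1 !mul1r ler_nat.
by case: (e c) (ef c) => // ->.
Qed.

Lemma prob_true : prob two (fun=> true) = 1.
Proof.
rewrite /prob (_ : event _ _ = setT) ?probability_setT//.
exact/seteqP.
Qed.

Lemma depends_and s s' (e f : pred (label -> bool)) :
  depends s e -> depends s' f -> depends (s ++ s') (fun c => e c && f c).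
Proof.
move=> de df c c' cc'; congr (_ && _).
  by apply: de => u us; apply: cc'; rewrite mem_cat us.
by apply: df => u us; apply: cc'; rewrite mem_cat us orbT.
Qed.

Lemma needs_size p u v : v \in needs p u -> (size v < size p + size u)%N.
Proof.
elim: u p => [//|b u IHu] p /=; rewrite mem_cat => /orP[|/IHu].
  by case: b => //; rewrite inE => /eqP ->; rewrite addnS ltnS leq_addr.
by rewrite size_rcons addnS.
Qed.

Definition joint p u u' : R := prob two (fun c => born c p u && born c p u').

(** The birth of [w] reads labels shorter than [p ++ w], the continuations only labels extending
    it. *)
Lemma joint_same p w u u' :
  joint p (w ++ u) (w ++ u') = birth_weight R w * joint (p ++ w) u u'.
Proof.
rewrite -(prob_born two_law two_indep p w) /joint.
rewrite -(prob_indep two_indep (@depends_born p w)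
  (depends_and (@depends_born (p ++ w) u) (@depends_born (p ++ w) u'))).
  by congr prob; apply/funext => c; rewrite !born_cat; case: (born c p w).
move=> v /needs_size vw; rewrite mem_cat.
by apply/negP => /orP[] /needs_prefix /size_prefix; rewrite size_cat leqNgt vw.
Qed.

(** Equal lengths make the subtrees disjoint; dropping the births of [w] and [w'] gives the
    inequality. *)
Lemma joint_diff p w w' u u' : size w = size w' -> w != w' ->
  joint p (w ++ u) (w' ++ u') <= birth_weight R u * birth_weight R u'.
Proof.
move=> sw ww'.
rewrite -(prob_born two_law two_indep (p ++ w) u).
rewrite -(prob_born two_law two_indep (p ++ w') u').
rewrite -(prob_indep two_indep (@depends_born (p ++ w) u) (@depends_born (p ++ w') u')).
  apply: prob_le; do ?[apply: depends_and; exact: depends_born].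
  by move=> c; rewrite !born_cat => /andP[/andP[_ ->] /andP[_ ->]].
move=> v /needs_prefix; rewrite prefixE => /eqP hv.
apply/negP => /needs_prefix; rewrite prefixE.
have -> : size (p ++ w') = size (p ++ w) by rewrite !size_cat sw.
by rewrite hv eqseq_cat// eqxx (negbTE ww').
Qed.

Variables (K : nat) (g : seq label).
Hypotheses (Ug : uniq g) (sg : {in g, forall u, size u = K}).
Let mu : R := \sum_(u <- g) birth_weight R u.
Hypothesis mu1 : 1 < mu.

(** The potential members of step [n] of the embedded Galton-Watson process, whose offspring mean is
    [mu]. *)
Fixpoint blocks (n : nat) : seq label :=
  if n is n'.+1 then [seq w ++ u | w <- g, u <- blocks n'] else [:: [::]].

Lemma size_blocks n : {in blocks n, forall u, size u = (n * K)%N}.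
Proof.
elim: n => [|n IHn] u /=; first by rewrite inE => /eqP ->.
by move=> /allpairsP[[w v] /= [/sg wK /IHn vn ->]]; rewrite size_cat wK vn mulSn.
Qed.

Lemma uniq_blocks n : uniq (blocks n).
Proof.
elim: n => [//|n IHn] /=; apply: allpairs_uniq => // -[w u] [w' u'].
move=> /allpairsP[[? ?] /= [/sg wg _ [-> ->]]] /allpairsP[[? ?] /= [/sg wg' _ [-> ->]]].
by move=> /eqP /=; rewrite eqseq_cat ?wg ?wg'// => /andP[/eqP -> /eqP ->].
Qed.

Lemma displacement_blocks (D : R) n : {in g, forall u, displacement R u <= D} ->
  {in blocks n, forall u, displacement R u <= n%:R * D}.
Proof.
move=> gD; elim: n => [|n IHn] u /=.
  by rewrite inE => /eqP ->; rewrite /displacement big_nil mul0r.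
move=> /allpairsP[[w v] /= [/gD wD /IHn vD ->]].
by rewrite displacement_cat -natr1; lra.
Qed.

Lemma sum_blocks n : \sum_(u <- blocks n) birth_weight R u = mu ^+ n.
Proof.
elim: n => [|n IHn] /=; first by rewrite big_seq1 /birth_weight big_nil.
rewrite big_allpairs_dep exprS -IHn mulr_suml; apply: eq_bigr => w _.
by rewrite mulr_sumr; apply: eq_bigr => u _; rewrite birth_weight_cat.
Qed.

(** Chosen so that [C * mu + (size g) ^ 2 <= C * mu ^ 2], which closes the induction below; the
    summand 1 covers step 0. *)
Let C : R := 1 + (size g)%:R ^+ 2 / (mu ^+ 2 - mu).

Lemma mu_sqr_gt : 0 < mu ^+ 2 - mu.
Proof.
have -> : mu ^+ 2 - mu = mu * (mu - 1) by ring.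
by rewrite mulr_gt0 ?subr_gt0// (lt_trans ltr01).
Qed.

Lemma C_gt0 : 0 < C.
Proof. by rewrite ltr_pwDl// divr_ge0 ?sqr_ge0// ltW// mu_sqr_gt. Qed.

(** Pairs are split by first block: a common one leaves the same problem with one step fewer,
    distinct ones are bounded by the product of means. *)
Lemma second_moment n p :
  \sum_(u <- blocks n) \sum_(u' <- blocks n) joint p u u' <= C * (mu ^+ n) ^+ 2.
Proof.
have C0 := C_gt0; have mu0 : 0 < mu := lt_trans ltr01 mu1.
elim: n p => [|n IHn] p.
  rewrite /= !big_seq1 /joint /born /= prob_true expr0 expr1n mulr1.
  by rewrite lerDl divr_ge0 ?sqr_ge0// ltW// mu_sqr_gt.
set m := (mu ^+ n) ^+ 2 in IHn *.
have m0 : 0 <= m by exact: sqr_ge0.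
have pair w w' : w \in g -> w' \in g ->
    \sum_(u <- blocks n) \sum_(u' <- blocks n) joint p (w ++ u) (w' ++ u') <=
    (w == w')%:R * (birth_weight R w * (C * m)) + m.
  move=> wg w'g; case: (eqVneq w w') => [<-|ww'] /=.
    rewrite mul1r ler_wpDr//.
    under eq_bigr do under eq_bigr do rewrite joint_same.
    under eq_bigr do rewrite -mulr_sumr.
    by rewrite -mulr_sumr; apply: ler_wpM2l; [exact: birth_weight_ge0|exact: IHn].
  rewrite mul0r add0r /m expr2 -sum_blocks mulr_suml; apply: ler_sum => u _.
  rewrite mulr_sumr; apply: ler_sum => u' _.
  by apply: joint_diff => //; rewrite !sg.
rewrite /= big_allpairs_dep.
under eq_bigr do under eq_bigr do rewrite big_allpairs_dep.
under eq_bigr do rewrite exchange_big.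
apply: (@le_trans _ _ (\sum_(w <- g) \sum_(w' <- g)
    ((w == w')%:R * (birth_weight R w * (C * m)) + m))).
  rewrite big_seq [leRHS]big_seq; apply: ler_sum => w wg.
  rewrite big_seq [leRHS]big_seq; apply: ler_sum => w' w'g.
  exact: pair.
apply: (@le_trans _ _ (mu * (C * m) + (size g)%:R ^+ 2 * m)).
  rewrite le_eqVlt; apply/orP; left; apply/eqP.
  under eq_bigr do rewrite big_split /=.
  rewrite big_split /=; congr (_ + _).
    rewrite mulr_suml !big_seq; apply: eq_bigr => w wg.
    rewrite (bigD1_seq w)//= eqxx mul1r big1 ?addr0// => w' ww'.
    by rewrite eq_sym (negbTE ww') mul0r.
  have sum_cst (z : R) : \sum_(w <- g) z = (size g)%:R * z.
    by rewrite big_const_seq count_predT iter_addr_0 mulr_natl.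
  by under eq_bigr do rewrite sum_cst; rewrite sum_cst mulrA.
have -> : C * (mu ^+ n.+1) ^+ 2 = C * (mu ^+ 2 * m) by rewrite /m -exprMn -exprS.
have gC : (size g)%:R ^+ 2 <= C * (mu ^+ 2 - mu).
  have h := mu_sqr_gt.
  by rewrite /C mulrDl mul1r divfK ?gt_eqF// ler_wpDl// ltW.
have := ler_wpM2r m0 gC; lra.
Qed.

(** Means are taken in [X <= M / 4 + (t / 2) * 1_A + X ^ 2 / (2 * t)], where [A] is the event
    [M / 4 <= X]; with [t = S / M] the last mean is at most [M / 2]. *)
Lemma paley_zygmund (r : seq label) (e : label -> pred (label -> bool))
    (s : label -> seq label) (M S : R) : (forall u, depends (s u) (e u)) ->
  0 < M -> 0 < S -> \sum_(u <- r) prob two (e u) = M ->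
  \sum_(u <- r) \sum_(u' <- r) prob two (fun c => e u c && e u' c) <= S ->
  M ^+ 2 / (2 * S) <= prob two (fun c => M / 4 <= \sum_(u <- r) (e u c)%:R).
Proof.
move=> de M0 S0 hM hS; pose X c : R := \sum_(u <- r) (e u c)%:R.
pose t := S / M; have t0 : 0 < t by exact: divr_gt0.
pose A : pred (label -> bool) := fun c => M / 4 <= X c.
have dA : depends (flatten [seq s u | u <- r]) A.
  move=> c c' cc'; rewrite /A /X; congr (_ <= _); apply: eq_big_seq => u ur.
  by congr (_ : bool)%:R; apply: de => v vu; apply: cc'; apply/flatten_mapP; exists u.
(* Indices of the right side: [None] for the constant, [Some None] for [A], the others for the pairs
   in [X ^ 2]. *)
pose b (j : option (option (label * label))) : R :=
  if j is Some j' then if j' is Some _ then 1 / (2 * t) else t / 2 else M / 4.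
pose f (j : option (option (label * label))) : pred (label -> bool) :=
  if j is Some j' then if j' is Some uu then fun c => e uu.1 c && e uu.2 c else A
  else fun=> true.
pose sf (j : option (option (label * label))) : seq label :=
  if j is Some j' then if j' is Some uu then s uu.1 ++ s uu.2
    else flatten [seq s u | u <- r] else [::].
pose q := [:: None, Some None & [seq Some (Some (u, u')) | u <- r, u' <- r]].
have := @le_weighted_events _ _ _ _ two label _ r q (fun=> 1) b e f s sf.
rewrite /q !big_cons !big_allpairs_dep /= prob_true mulr1.
under eq_bigr do rewrite mul1r.
rewrite hM.
under [in X in _ -> M <= X]eq_bigr do rewrite -mulr_sumr.
rewrite -mulr_sumr => H.
have {H} : M <= M / 4 + (t / 2 * prob two A + 1 / (2 * t) *
    \sum_(u <- r) \sum_(u' <- r) prob two (fun c => e u c && e u' c)).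
  apply: H => //.
  - by move=> [[uu|]|] /=; apply: divr_ge0 => //; lra.
  - by move=> [[uu|]|] //=; exact: depends_and.
  move=> c; rewrite !big_cons big_allpairs_dep /= mulr1.
  under eq_bigr do rewrite mul1r.
  rewrite -/(X c).
  under [in X in _ <= X]eq_bigr do rewrite -mulr_sumr.
  rewrite -mulr_sumr.
  have -> : \sum_(u <- r) \sum_(u' <- r) (e u c && e u' c)%:R = X c ^+ 2 :> R.
    rewrite expr2 mulr_suml; apply: eq_bigr => u _; rewrite mulr_sumr.
    by apply: eq_bigr => u' _; rewrite -natrM mulnb.
  have X0 : 0 <= X c by exact: sumr_ge0.
  have h2 : 0 <= 1 / (2 * t) * X c ^+ 2.
    by rewrite mulr_ge0 ?sqr_ge0// divr_ge0// mulr_ge0// ltW.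
  rewrite /A; case: (leP (M / 4) (X c)) => /= h; last by rewrite mulr0; lra.
  rewrite mulr1.
  (* AM-GM: [X <= t / 2 + X ^+ 2 / (2 t)] *)
  have : X c <= t / 2 + 1 / (2 * t) * X c ^+ 2.
    rewrite -subr_ge0.
    have -> : t / 2 + 1 / (2 * t) * X c ^+ 2 - X c = (t - X c) ^+ 2 / (2 * t).
      by field; rewrite gt_eqF.
    by rewrite divr_ge0 ?sqr_ge0// mulr_ge0// ltW.
  by lra.
have hS' : 1 / (2 * t) * \sum_(u <- r) \sum_(u' <- r)
    prob two (fun c => e u c && e u' c) <= M / 2.
  apply: (@le_trans _ _ (1 / (2 * t) * S)).
    by rewrite ler_wpM2l// divr_ge0// mulr_ge0// ltW.
  rewrite le_eqVlt; apply/orP; left; apply/eqP.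
  by rewrite /t; field; rewrite !gt_eqF.
move=> h; have : M / 2 <= t * prob two A by lra.
move=> h'; rewrite -/(prob two A) ler_pdivrMr ?mulr_gt0//.
have : M * (M / 2) <= M * (t * prob two A) by rewrite ler_pM2l.
have -> : M * (t * prob two A) = S * prob two A by rewrite /t; field; rewrite gt_eqF.
by rewrite expr2; lra.
Qed.

Definition spine (j : nat) : label := nseq j false.

(** Size at step [n] of the block process started from the second child of [spine j]. *)
Definition offshoot (n j : nat) (c : label -> bool) : R :=
  \sum_(u <- blocks n) (born c (spine j) (true :: u))%:R.

Definition offshoot_needs n j :=
  flatten [seq needs (spine j) (true :: u) | u <- blocks n].

Lemma depends_offshoot n j c c' : {in offshoot_needs n j, c =1 c'} ->
  offshoot n j c = offshoot n j c'.
Proof.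
move=> cc'; apply: eq_big_seq => u un; congr (_ : bool)%:R.
by apply: depends_born => v vu; apply: cc'; apply/flatten_mapP; exists u.
Qed.

(** The first [true] of [v] identifies [j] (for [spine j] itself, [find] returns its length), so
    distinct offshoots read disjoint labels. *)
Lemma offshoot_needs_find n j v : v \in offshoot_needs n j -> find id v = j.
Proof.
have nf : find id (nseq j false) = j by rewrite -[RHS](size_nseq j false) hasNfind// has_nseq andbF.
move=> /flatten_mapP[u _] /=; rewrite inE => /orP[/eqP ->//|].
move=> /needs_prefix /prefixP[w ->].
by rewrite /spine cat_rcons find_cat has_nseq andbF /= addn0 size_nseq.
Qed.

(** The birth of the second child multiplies both moments by 1/5, so the ratio becomes
    [1 / (10 * C)]. *)
Lemma offshoot_large n j :
  1 / (10 * C) <= prob two (fun c => mu ^+ n / 5 / 4 <= offshoot n j c).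
Proof.
have C0 := C_gt0; have m0 : 0 < mu ^+ n by rewrite exprn_gt0// (lt_trans ltr01).
have := @paley_zygmund (blocks n) (fun u c => born c (spine j) (true :: u))
  (fun u => needs (spine j) (true :: u)) (mu ^+ n / 5) (C * (mu ^+ n) ^+ 2 / 5).
have -> : (mu ^+ n / 5) ^+ 2 / (2 * (C * (mu ^+ n) ^+ 2 / 5)) = 1 / (10 * C).
  by field; rewrite !gt_eqF.
apply.
- by move=> u; exact: depends_born.
- by rewrite divr_gt0.
- by rewrite divr_gt0// mulr_gt0// exprn_gt0.
- under eq_bigr do rewrite prob_born// -cat1s birth_weight_cat.
  by rewrite -mulr_sumr sum_blocks /birth_weight big_seq1; lra.
- have e u u' : prob two (fun c => born c (spine j) (true :: u) &&
      born c (spine j) (true :: u')) = 1 / 5 * joint (spine j ++ [:: true]) u u'.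
    have := joint_same (spine j) [:: true] u u'.
    by rewrite /birth_weight big_seq1.
  under eq_bigr do (under eq_bigr do rewrite e; rewrite -mulr_sumr).
  rewrite -mulr_sumr.
  have := second_moment n (spine j ++ [:: true]); lra.
Qed.

Lemma eventually_offshoot : {ae P, forall omega, exists n0, forall n, (n0 <= n)%N ->
  exists2 j, (j < n)%N & mu ^+ n / 5 / 4 <= offshoot n j (config two omega)}.
Proof.
have C0 := C_gt0; pose q := 1 - 1 / (10 * C).
pose bad n j : pred (label -> bool) := fun c => ~~ (mu ^+ n / 5 / 4 <= offshoot n j c).
have dgood n j : depends (offshoot_needs n j) (fun c => mu ^+ n / 5 / 4 <= offshoot n j c).
  by move=> c c' /depends_offshoot ->.
have dbad n j : depends (offshoot_needs n j) (bad n j).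
  by move=> c c' /depends_offshoot h; rewrite /bad h.
have pbad n j : prob two (bad n j) <= q.
  by rewrite (prob_compl two (dgood n j)) lerD2l lerN2 offshoot_large.
have q01 : 0 <= q < 1.
  rewrite (le_trans (prob_ge0 _ _) (pbad 0%N 0%N)) /q ltrBlDr ltrDl.
  by rewrite divr_gt0// mulr_gt0.
have dall n : depends (flatten [seq offshoot_needs n j | j <- iota 0 n])
    (fun c => all (fun j => bad n j c) (iota 0 n)).
  move=> c c' cc'; apply: eq_in_all => j jn; apply: dbad => u us.
  by apply: cc'; apply/flatten_mapP; exists j.
have := eventually_not dall q01 (fun n => prob_forall_le two_indep n (dbad n)
  (fun i j u ui uj => eq_trans (esym (offshoot_needs_find ui)) (offshoot_needs_find uj))
  (pbad n)).
apply: filterS => omega [n0 h]; exists n0 => n /h /allPn[j].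
by rewrite mem_iota add0n /= negbK => jn hj; exists j.
Qed.

(** The spine costs at most [n * ln 2]; the negative displacement [ln (2/5)] of the second child is
    discarded. *)
Lemma offshoot_le_low_count (start D : R) c n j x :
  {in g, forall u, displacement R u <= D} -> (j < n)%N -> 0 < x ->
  start + n%:R * (D + ln 2) <= ln x ->
  offshoot n j c <= (low_count start c (j + (n * K).+1) x)%:R.
Proof.
move=> gD jn x0 hx; pose r := [seq u <- blocks n | born c (spine j) (true :: u)].
have -> : offshoot n j c = (size r)%:R.
  rewrite size_filter -sum1_count big_mkcond natr_sum; apply: eq_bigr => u _.
  by case: (born _ _ _).
rewrite ler_nat /low_count -size_filter -(size_map (fun u => spine j ++ true :: u)).
apply: uniq_leq_size.
  rewrite map_inj_uniq ?filter_uniq ?uniq_blocks// => u u' /eqP.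
  by rewrite eqseq_cat// => /andP[_ /eqP[]].
move=> _ /mapP[u + ->]; rewrite !mem_filter => /andP[bu un].
rewrite mem_words size_cat /= size_nseq (size_blocks un) eqxx andbT.
rewrite born_cat /= bu andbT.
have -> : born c [::] (spine j).
  by rewrite /born /spine; elim: (j) [::] => //= k IHk p; exact: IHk.
rewrite /= -ler_ln ?posrE ?expR_gt0// expRK.
apply: le_trans hx; rewrite lerD2l displacement_cat -cat1s displacement_cat.
have h1 : displacement R (spine j) = j%:R * ln 2.
  by rewrite /displacement /spine big_nseq iter_addr_0 mulr_natl.
have h2 : displacement R [:: true] = ln (2 / 5) by rewrite /displacement big_seq1.
have h3 := displacement_blocks gD un.
have h4 : j%:R * ln 2 <= n%:R * ln 2 :> R.
  by rewrite ler_pM2r ?ln2_gt0// ler_nat ltnW.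
have := ln25_lt0 R; rewrite h1 h2 mulrDr; lra.
Qed.

Lemma Istar_lower_blocks (start D a : R) : 0 <= D ->
  {in g, forall u, displacement R u <= D} -> 0 < a -> a * (D + ln 2) < ln mu ->
  {ae P, forall omega, exists2 B : R, 0 < B & exists x0 : R, forall x, x0 <= x ->
    ((B * x `^ a)%:E <= Istar start (config two omega) x)%E}.
Proof.
move=> D0 gD a0 hmu; have ln20 := ln2_gt0 R; pose b := D + ln 2.
have b0 : 0 < b by rewrite /b; lra.
have mu0 : 0 < mu := lt_trans ltr01 mu1.
apply: filterS eventually_offshoot => omega [n0 h].
(* [20 = 5 * 4] comes from the bound on [offshoot], and [b] pays for rounding [n] down. *)
exists (expR (- a * (start + b)) / 20); first by rewrite divr_gt0 ?expR_gt0.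
exists (expR (start + (n0%:R + 1) * b)) => x hx.
have x0 : 0 < x by exact: lt_le_trans (expR_gt0 _) hx.
have lnx : start + (n0%:R + 1) * b <= ln x by rewrite -ler_expR lnK.
(* The position budget allows [y] steps; the threshold on [x] makes [y >= n0 + 1], hence its integer
   part [n] is at least [n0]. *)
pose y := (ln x - start) / b.
have y0 : 0 <= y.
  apply: divr_ge0; last exact: ltW.
  by have : 0 <= (n0%:R + 1) * b; [rewrite mulr_ge0 ?addr_ge0// ltW | lra].
have /andP[ny yn] := truncn_itv y0.
set n := Num.truncn y in ny yn.
have n0n : (n0 <= n)%N.
  rewrite -(ler_nat R).
  have : n0%:R + 1 <= y by rewrite /y ler_pdivlMr//; lra.
  move: yn; rewrite -natr1; lra.
have [j jn hj] := h n n0n.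
have hx' : start + n%:R * (D + ln 2) <= ln x.
  by rewrite addrC -lerBrDr -/b -ler_pdivlMr.
apply: le_trans (Istar_ge start _ x (_ : 1 <= j + (n * K).+1)%N); last by rewrite addnS.
rewrite lee_fin; apply: le_trans (offshoot_le_low_count _ gD jn x0 hx').
apply: le_trans hj.
have : expR (- a * (start + b)) * x `^ a <= mu ^+ n.
  rewrite /powR gt_eqF// -expRD -[leRHS]lnK ?posrE ?exprn_gt0// ler_expR lnXn//.
  rewrite -mulr_natl.
  have : n%:R * (a * b) <= n%:R * ln mu by rewrite ler_wpM2l// ltW.
  have : a * (ln x - start) <= a * (n%:R * b + b).
    rewrite ler_pM2l//; move: yn; rewrite /y ltr_pdivrMr// -natr1; lra.
  rewrite -/b; nra.
have scale (p q : R) : p <= q -> p / 20 <= q / 5 / 4 by lra.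
by move=> /scale; rewrite mulrAC.
Qed.

End SecondMoment.

(** * From the two bounds to the exponent *)

(** After division by [ln x], the constants [C] and [B] contribute only [O(1 / ln x)] to the
    exponent. *)
Lemma power_asymptotics_squeeze (R : realType) (F : R -> \bar R) (eta : R)
    (e : nat -> R) : (forall eps, 0 < eps -> exists m, e m <= eps) ->
  (forall m, exists2 C : R, 0 < C &
    forall x, 1 <= x -> (F x <= (C * x `^ (eta + e m))%:E)%E) ->
  (forall m, exists2 B : R, 0 < B & exists x0 : R, forall x, x0 <= x ->
    ((B * x `^ (eta - e m))%:E <= F x)%E) ->
  power_asymptotics F eta.
Proof.
move=> e_small upper lower.
pose eps x : R := ln (fine (F x)) / ln x - eta.
have Flog m : exists A : R, \forall x \near +oo,
    [/\ 1 < x, F x \is a fin_num, 0 < fine (F x) & `|eps x| <= e m + A / ln x].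
  have [C C0 hC] := upper m; have [B B0 [x0 hB]] := lower m.
  exists (`|ln C| + `|ln B|); near=> x.
  have x1 : 1 < x by near: x; exact: nbhs_pinfty_gt.
  have xgt0 : 0 < x by exact: lt_trans x1.
  have Fu := hC x (ltW x1).
  have Fl : ((B * x `^ (eta - e m))%:E <= F x)%E.
    by apply: hB; near: x; apply: nbhs_pinfty_ge; exact: num_real.
  have Bx : 0 < B * x `^ (eta - e m) by rewrite mulr_gt0 ?powR_gt0.
  have Cx : 0 < C * x `^ (eta + e m) by rewrite mulr_gt0 ?powR_gt0.
  move: Fu Fl; rewrite /eps.
  case: (F x) => [r| |]; rewrite ?leye_eq ?leeNy_eq// !lee_fin /= => Fu Fl.
  have r0 : 0 < r := lt_le_trans Bx Fl.
  split=> //; have lx : 0 < ln x by rewrite ln_gt0.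
  have lu : ln r <= ln C + (eta + e m) * ln x.
    by rewrite -ln_powR -lnM ?posrE ?powR_gt0// ler_ln ?posrE.
  have ll : ln B + (eta - e m) * ln x <= ln r.
    by rewrite -ln_powR -lnM ?posrE ?powR_gt0// ler_ln ?posrE.
  have -> : ln r / ln x - eta = (ln r - eta * ln x) / ln x.
    by field; rewrite gt_eqF.
  have -> : e m + (`|ln C| + `|ln B|) / ln x = (e m * ln x + (`|ln C| + `|ln B|)) / ln x.
    by field; rewrite gt_eqF.
  rewrite normrM normfV (gtr0_norm lx) ler_pM2r ?invr_gt0// ler_norml.
  have := ler_norm (ln C); have := normr_ge0 (ln C).
  have := ler_norm (- ln B); rewrite normrN; have := normr_ge0 (ln B).
  by move=> *; apply/andP; split; lra.
exists eps; split; last first.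
  have [A] := Flog 0%N; apply: filterS => x [x1 Ffin F0 _].
  have lx : 0 < ln x by rewrite ln_gt0.
  rewrite /eps addrC subrK /powR gt_eqF ?(lt_trans ltr01)//.
  by rewrite divfK ?gt_eqF// lnK ?posrE// fineK.
apply/cvgrPdist_le => delta delta0.
have [|m em] := e_small (delta / 2); first by rewrite divr_gt0.
have [A hA] := Flog m; near=> x; rewrite sub0r normrN.
have [x1 _ _ h] : [/\ 1 < x, F x \is a fin_num, 0 < fine (F x)
    & `|eps x| <= e m + A / ln x] by near: x.
have lx : 0 < ln x by rewrite ln_gt0.
have lA : A / ln x <= delta / 2.
  rewrite ler_pdivrMr// mulrC -ler_pdivrMr ?divr_gt0//.
  rewrite -ler_expR lnK ?posrE ?(lt_trans ltr01)//.
by apply: le_trans h _; lra.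
Unshelve. all: by end_near. Qed.

Theorem theorem8p10 (R : realType) (d : measure_display) (T : measurableType d)
    (P : probability T R) (two : label -> {RV P >-> bool}) (start : R)
    (two_law : reproduction_law two) (two_indep : mutually_independent two) :
  exists eta5BP : R,
    [/\ is_maximum_on [set a : R | 0 < a < 1 / 6 * ln (64 / 5)] (@f5BP R) eta5BP,
        `|eta5BP - (650 / 10 ^+ 3 + 919 / 10 ^+ 6)| <= 5 / 10 ^+ 7
      & {ae P, forall omega,
          power_asymptotics (Istar start (fun u => two u omega)) eta5BP}].
Proof.
have [eta phi_eta eta_near] := exists_phi_root R.
have eta_bounds : 1 / 2 < eta < 2 / 3.
  by move: eta_near; rewrite ler_norml => /andP[]; lra.
exists eta; split=> //; first exact: maximum_f5BP.
(* Countably many errors, so that the null sets can be united. The shift to [m.+2] keeps [eta + e m]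
   strictly below 2/3, where [phi_lt1] applies. *)
pose e (m : nat) : R := (2 / 3 - eta) / m.+2%:R.
have e_bounds m : 0 < e m < 2 / 3 - eta.
  have e0 : 0 < 2 / 3 - eta by move: eta_bounds; lra.
  by rewrite divr_gt0//= ltr_pdivrMr// ltr_pMr// ltr1n.
have upper m : {ae P, forall omega, exists2 C : R, 0 < C & forall x, 1 <= x ->
    (Istar start (fun u => two u omega) x <= (C * x `^ (eta + e m))%:E)%E}.
  have := e_bounds m => em; apply: Istar_upper => //.
    by move: em eta_bounds; lra.
  by apply: (phi_lt1 phi_eta eta_bounds); move: em eta_bounds; lra.
have lower m : {ae P, forall omega, exists2 B : R, 0 < B & exists x0 : R,
    forall x, x0 <= x ->
    ((B * x `^ (eta - e m))%:E <= Istar start (fun u => two u omega) x)%E}.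
  have em : 0 < e m < eta by move: (e_bounds m) eta_bounds; lra.
  have [K [g [D [Ug sg [gD D0] mu1 hmu]]]] := good_block phi_eta eta_bounds em.
  apply: (Istar_lower_blocks two_law two_indep Ug sg mu1 start D0 gD _ hmu).
  by rewrite subr_gt0; case/andP: em.
have := ae_foralln upper; have := ae_foralln lower.
apply: filterS2 => omega hl hu; apply: (power_asymptotics_squeeze _ hu hl).
move=> eps eps0; exists (Num.Def.archi_bound (1 / eps)).
have := archi_boundP (divr_ge0 ler01 (ltW eps0)).
set b := Num.Def.archi_bound _ => hb.
rewrite ler_pdivrMr//; move: hb; rewrite ltr_pdivrMr// => hb.
apply: (@le_trans _ _ 1); first by move: eta_bounds; lra.
apply: (le_trans (ltW hb)); rewrite mulrC ler_pM2l// ler_nat.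
by rewrite (leq_trans (leqnSn _))// leqnSn.
Qed.
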